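(* Let $n\ge 1$, $\alpha\in(0,1)$, $p\in(1,\frac n\alpha)$, $q\in[1,\infty)$, and let $\nu$ be a nonnegative outer measure on $\mathbb{R}^{1+n}_+=(0,\infty)\times\mathbb{R}^n$. For a function $f$ on $\mathbb{R}^n$ let $$w(t,x)=(4\pi t)^{-\frac n2}\int_{\mathbb{R}^n}\exp\Big(-\frac{|x-y|^2}{4t}\Big)f(y)\,dy$$ be the solution of the heat equation $(\partial_t-\Delta_x)w(t,x)=0$ for $(t,x)\in\mathbb{R}^{1+n}_+$ with $w(0,x)=f(x)$ for $x\in\mathbb{R}^n$. Then the following two statements are equivalent: (i) There is a constant $c>0$ such that for all $f\in\Lambda^{p,\infty}_\alpha\cap C(\mathbb{R}^n)$, $$\sup_{\lambda\in(0,\infty)}\Big(\lambda^q\nu\big(\{(t,x)\in\mathbb{R}^{1+n}_+:|w(t^2,x)|>\lambda\}\big)\Big)^{\frac1q}\le c\,\|f\|_{\dot{\Lambda}^{p,\infty}_\alpha}.$$ (ii) There is a constant $c>0$ such that for all open sets $O\subset\mathbb{R}^n$, $$\nu\big(T(O)\big)\le c\,\big(C_{\alpha,p,\infty}(O)\big)^{\frac qp}.$$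
   Context: For $h\in\mathbb{R}^n$ and $f:\mathbb{R}^n\to\mathbb{R}$ set $\Delta_h f(x)=f(x+h)-f(x)$. For $\alpha\in(0,1)$ and $p\in[1,\infty)$, $\Lambda^{p,\infty}_\alpha$ is the class of all $f\in L^p(\mathbb{R}^n)$ with $$\|f\|_{\dot{\Lambda}^{p,\infty}_\alpha}=\sup_{h\in\mathbb{R}^n\setminus\{0\}}|h|^{-\alpha}\|\Delta_h f\|_{L^p}<\infty.$$ $C(\mathbb{R}^n)$ is the class of continuous functions on $\mathbb{R}^n$. For $E\subset\mathbb{R}^n$ let $\mathsf{A}_{\alpha,p,\infty}(E)$ be the set of $f\in\Lambda^{p,\infty}_\alpha\cap C(\mathbb{R}^n)$ such that $f\ge 1$ on some (open) neighbourhood $N$ of $E$. The $\infty$-Besov capacity of $E$ is $$C_{\alpha,p,\infty}(E)=\inf\{\|f\|^p_{\dot{\Lambda}^{p,\infty}_\alpha}: f\in\mathsf{A}_{\alpha,p,\infty}(E)\},$$ with the usual convention $\inf\emptyset=+\infty$. $B(x,t)$ is the Euclidean ball with centre $x$ and radius $t$. For an open set $O\subset\mathbb{R}^n$, the tent with base $O$ is $T(O)=\{(t,x)\in\mathbb{R}^{1+n}_+:B(x,t)\subseteq O\}$. *)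

(* Defs.v *)
From HB Require Import structures.
From mathcomp Require Import all_boot all_order all_algebra.
From mathcomp Require Import all_classical all_reals all_analysis.

Set Implicit Arguments.
Unset Strict Implicit.
Unset Printing Implicit Defensive.

Import Order.TTheory GRing.Theory Num.Theory.
Import numFieldNormedType.Exports.

Local Open Scope classical_set_scope.
Local Open Scope ring_scope.

Definition measure_rV_display : measure_display -> measure_display.
Proof. exact. Qed.

Section measurable_rV.
Context {d} {T : sigmaRingType d}.
Variable n : nat.

Let coors : 'I_n -> 'rV[T]_n -> T := fun i x => x ord0 i.

Let rV_set0 : g_sigma_preimage coors set0.
Proof. exact: sigma_algebra0. Qed.

Let rV_setC A : g_sigma_preimage coors A -> g_sigma_preimage coors (~` A).
Proof. exact: sigma_algebraC. Qed.

Let rV_bigcup (F : _^nat) : (forall i, g_sigma_preimage coors (F i)) ->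
  g_sigma_preimage coors (\bigcup_i (F i)).
Proof. exact: sigma_algebra_bigcup. Qed.

(* The product sigma-algebra on row vectors, generated by the coordinate maps
   (the analogue for 'rV[T]_n of the library's instance for n.-tuple T); it is
   the Borel sigma-algebra when T is the real line. *)
HB.instance Definition _ := @isMeasurable.Build (measure_rV_display d)
  'rV[T]_n (g_sigma_preimage coors) rV_set0 rV_setC rV_bigcup.

End measurable_rV.

Lemma measurable_rV_coord d (T : sigmaRingType d) n (i : 'I_n) :
  measurable_fun [set: 'rV[T]_n] (fun x : 'rV[T]_n => x ord0 i).
Proof.
move=> _ Y mY; rewrite setTI; apply: sub_sigma_algebra => /=.
rewrite -bigcup_seq/=; exists i => /=; first by rewrite mem_index_enum.
by exists Y => //; rewrite setTI.
Qed.

Lemma measurable_fun_rVP d1 d2 (T1 : measurableType d1)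
    (T2 : measurableType d2) n (f : T1 -> 'rV[T2]_n) :
  (forall i, measurable_fun [set: T1] (fun x => f x ord0 i)) ->
  measurable_fun [set: T1] f.
Proof.
move=> mf; pose c := fun (i : 'I_n) (x : 'rV[T2]_n) => x ord0 i.
suff : g_sigma_preimage (fun i => c i \o f) `<=` measurable.
  have -> : g_sigma_preimage (fun i => c i \o f) =
      preimage_set_system [set: T1] f (g_sigma_preimage c).
    rewrite -g_sigma_preimageE; congr (<<s _ >>).
    rewrite (big_morph _ (preimage_set_systemU _ _) (preimage_set_system0 _ _)).
    by apply: eq_bigr => i _; rewrite -preimage_set_system_comp.
  by move=> prefS _ A mA; apply: prefS; exists A.
apply: smallest_sub; first exact: sigma_algebra_measurable.
by rewrite -bigcup_seq; apply: bigcup_sub => i _ _ [B mB <-]; exact: mf.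
Qed.

Section lebesgue_measure_rV.
Context {R : realType}.

(* The identification of R * R^n with R^(n+1). *)
Definition rV_cons n (z : R * 'rV[R]_n) : 'rV[R]_n.+1 :=
  row_mx (const_mx z.1 : 'rV[R]_1) z.2.

Lemma rV_cons0 n (z : R * 'rV[R]_n) : rV_cons z ord0 ord0 = z.1.
Proof.
rewrite /rV_cons; have -> : ord0 = lshift n ord0 :> 'I_(1 + n) by apply/val_inj.
by rewrite (row_mxEl (const_mx z.1 : 'rV[R]_1)) mxE.
Qed.

Lemma rV_consS n (z : R * 'rV[R]_n) (i : 'I_n) :
  rV_cons z ord0 (lift ord0 i) = z.2 ord0 i.
Proof.
rewrite /rV_cons.
have -> : lift ord0 i = rshift 1 i :> 'I_(1 + n) by apply/val_inj.
by rewrite (row_mxEr (const_mx z.1 : 'rV[R]_1)).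
Qed.

Lemma measurable_rV_cons n : measurable_fun setT (@rV_cons n).
Proof.
apply: measurable_fun_rVP => i; case: (unliftP ord0 i) => [j|] ->.
- under eq_fun do rewrite rV_consS.
  by apply: measurableT_comp (@measurable_rV_coord _ _ n j) _.
- by under eq_fun do rewrite rV_cons0; exact: measurable_fst.
Qed.

Section step.
Variables (n : nat) (mu : {sigma_finite_measure set 'rV[R]_n -> \bar R}).

Definition lebesgue_rV_step : set 'rV[R]_n.+1 -> \bar R :=
  pushforward (lebesgue_measure \x mu)%E (@rV_cons n).

Let pushforward_step :=
  measure_function_pushforward__canonical__measure_function_Measure
    (lebesgue_measure \x mu)%E (@measurable_rV_cons n).

HB.instance Definition _ := Measure.copy lebesgue_rV_step pushforward_step.

Let sigma_finite_step : sigma_finite setT lebesgue_rV_step.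
Proof.
have /sigma_finiteP[F [FT ndF Foo]] := @sigma_finiteT _ _ _ (@lebesgue_measure R).
have /sigma_finiteP[G [GT ndG Goo]] := sigma_finiteT mu.
pose H k := [set x : 'rV[R]_n.+1 | F k (x ord0 ord0)] `&`
  [set x : 'rV[R]_n.+1 | G k (\row_i x ord0 (lift ord0 i))].
exists H.
  apply/esym; rewrite -subTset => x _.
  have : (\bigcup_k F k) (x ord0 ord0) by rewrite -FT.
  move=> -[k _ Fk].
  have : (\bigcup_k G k) (\row_i x ord0 (lift ord0 i)) by rewrite -GT.
  move=> -[l _ Gl].
  exists (maxn k l) => //; split => /=.
  - by have /subsetPset := ndF _ _ (leq_maxl k l); exact.
  - by have /subsetPset := ndG _ _ (leq_maxr k l); exact.
move=> k; have [mF Fy] := Foo k; have [mG Gy] := Goo k; split.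
  apply: measurableI.
    by rewrite -[X in measurable X]setTI; exact: measurable_rV_coord.
  rewrite -[X in measurable X]setTI; apply: measurable_fun_rVP => // i.
  by under eq_fun do rewrite mxE; exact: measurable_rV_coord.
rewrite /lebesgue_rV_step /pushforward.
have -> : @rV_cons n @^-1` H k = F k `*` G k.
  apply/seteqP; split => -[a x]; rewrite /H/= rV_cons0.
    have -> : \row_i rV_cons (a, x) ord0 (lift ord0 i) = x.
      by apply/rowP => i; rewrite mxE rV_consS.
    by [].
  have -> : \row_i rV_cons (a, x) ord0 (lift ord0 i) = x.
    by apply/rowP => i; rewrite mxE rV_consS.
  by [].
by rewrite product_measure1E// lte_mul_pinfty// ge0_fin_numE.
Qed.

HB.instance Definition _ :=
  Measure_isSigmaFinite.Build _ _ _ lebesgue_rV_step sigma_finite_step.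

End step.

(* n-dimensional Lebesgue measure, as the n-fold product of the Lebesgue measure
   on the real line transported to row vectors; the dimension 0 case is the unit
   point mass. *)
Fixpoint lebesgue_rV n : {sigma_finite_measure set 'rV[R]_n -> \bar R} :=
  match n with
  | 0 => \d_(0 : 'rV[R]_0)
  | m.+1 => lebesgue_rV_step (lebesgue_rV m)
  end.

Lemma measurable_box n (A : 'I_n -> set R) : (forall i, measurable (A i)) ->
  measurable [set x : 'rV[R]_n | forall i, A i (x ord0 i)].
Proof.
move=> mA.
have -> : [set x : 'rV[R]_n | forall i, A i (x ord0 i)] =
    \big[setI/setT]_(i < n) [set x : 'rV[R]_n | A i (x ord0 i)].
  rewrite -bigcap_seq; apply/seteqP; split=> [x Ax i _|x Ax i]; first exact: Ax.
  by apply: Ax => /=; rewrite mem_index_enum.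
apply: bigsetI_measurable => i _.
by rewrite -[X in measurable X]setTI; exact: measurable_rV_coord.
Qed.

Lemma lebesgue_rV_box n (A : 'I_n -> set R) : (forall i, measurable (A i)) ->
  lebesgue_rV n [set x : 'rV[R]_n | forall i, A i (x ord0 i)] =
  (\prod_(i < n) lebesgue_measure (A i))%E.
Proof.
elim: n A => [|n ih] A mA.
  by rewrite big_ord0 /= diracE mem_set// => -[].
rewrite big_ord_recl -ih//= /lebesgue_rV_step /pushforward.
have -> : @rV_cons n @^-1` [set x : 'rV[R]_n.+1 | forall i, A i (x ord0 i)] =
    A ord0 `*` [set x : 'rV[R]_n | forall i, A (lift ord0 i) (x ord0 i)].
  apply/seteqP; split => -[a x] /=.
    move=> Aax; split => [|i]; first by have := Aax ord0; rewrite rV_cons0.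
    by have := Aax (lift ord0 i); rewrite rV_consS.
  move=> [Aa Ax] i; case: (unliftP ord0 i) => [j|] ->.
    by rewrite rV_consS.
  by rewrite rV_cons0.
rewrite product_measure1E//; first exact: mA.
exact: measurable_box (fun i => mA (lift ord0 i)).
Qed.

End lebesgue_measure_rV.

Section besov_capacity.
Context {R : realType} {n : nat}.
Implicit Types (f : 'rV[R]_n -> R) (x y h : 'rV[R]_n) (E O : set 'rV[R]_n).
Implicit Types (alpha p t : R).

(* The library's norm `|x| on 'rV[R]_n is the maximum norm. *)
Definition euclidean_norm x : R := Num.sqrt (\sum_i x ord0 i ^+ 2).

Definition euclidean_ball x t : set 'rV[R]_n :=
  [set y | euclidean_norm (y - x) < t].

Definition difference h f : 'rV[R]_n -> R := fun x => f (x + h) - f x.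

Definition besov_seminorm alpha p f : \bar R :=
  ereal_sup [set ((euclidean_norm h `^ (- alpha))%:E *
                  'N[lebesgue_rV n]_p%:E[EFin \o difference h f])%E |
             h in [set h | h != 0]].

Definition besov_space alpha p : set ('rV[R]_n -> R) :=
  [set f | f \in Lfun (lebesgue_rV n) p%:E /\
           (besov_seminorm alpha p f < +oo)%E].

Definition besov_admissible alpha p E : set ('rV[R]_n -> R) :=
  [set f | [/\ besov_space alpha p f, continuous f &
            exists N : set 'rV[R]_n,
              [/\ open N, E `<=` N & forall x, N x -> 1 <= f x]]].

Definition besov_capacity alpha p E : \bar R :=
  ereal_inf [set (besov_seminorm alpha p f `^ p)%E |
             f in besov_admissible alpha p E].

Definition heat_extension f t x : R :=
  (4 * pi * t) `^ (- (n%:R / 2)) *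
  \int[lebesgue_rV n]_y
    (expR (- (euclidean_norm (x - y) ^+ 2 / (4 * t))) * f y).

(* The upper half-space (0, +oo) x R^n is the type {posnum R} * 'rV[R]_n. *)
Definition tent O : set ({posnum R} * 'rV[R]_n) :=
  [set z | euclidean_ball z.2 z.1%:num `<=` O].

End besov_capacity.

(* Main.v *)
(* The heat extension at a point (t, y) with |x - y| < t is dominated by an average
   of |f| around x against the kernel (c/2)^n exp(-c |u|_1) with c comparable to
   1/t, so a superlevel set of w lies in the tent over a superlevel set of
   g = sup_j A_j |f|, where A_j averages at the scale c = c0 2^j and c0 is chosen so
   small that |w| is below the level at all times t > 1/c0.  No maximal theorem is
   needed to see that g is admissible.  For f >= 0 and Q_j(x) = A_j(|f - f(x)|)(x),
     |A_j f - f| <= Q_j  and  |A_j f(x + h) - A_j f(x)| <= (exp(c |h|_1) - 1) Q_j(x),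
   and the integral of Q_j^p decays like c^(- alpha p), so the supremum can be
   replaced by a sum over j; it is geometric on both sides of c |h|_1 = 1 because
   0 < alpha < 1.  Conversely, if f >= 1 on a neighbourhood of O then the heat
   extension of |f| is bounded below on the tent over O by a constant depending
   only on the dimension. *)
Require Import Defs.
From mathcomp Require Import all_boot all_order all_algebra.
From mathcomp Require Import all_classical all_reals all_analysis.
From mathcomp Require Import measurable_realfun ring lra.

Set Implicit Arguments.
Unset Strict Implicit.
Unset Printing Implicit Defensive.

Import Order.TTheory GRing.Theory Num.Theory.
Import numFieldNormedType.Exports.

Local Open Scope classical_set_scope.
Local Open Scope ring_scope.

(** * Translation invariance of the Lebesgue measure *)

(** Since c0 is chosen after the level and f, no constant that survives the supremum over levels may
    depend on it. Membership of g in L^p may degrade as c0 tends to 0, because only finiteness is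
    used. The seminorm bound must be uniform in c0, so it is derived from the differences of f
    alone, with sums over scales bounded independently of c0 and |h|_1. Starting the scales at c0,
    instead of letting j run over all integers, is what keeps g in L^p: the decay c^(- alpha p) is
    summable only towards large c. The kernel exp(- c |u|_1) replaces the Gaussian because a
    translation by h changes it at most by the factor exp(c |h|_1), uniformly in u; a Gaussian
    admits no such bound. The capacity also demands that g be continuous, which a supremum of
    infinitely many continuous functions need not be. For continuous f, however, all averages at
    sufficiently fine scales stay below f(x) + e on a neighbourhood of x, so only finitely many
    indices can raise the supremum there. *)

Section lebesgue_translation.
Context {R : realType}.
Local Notation leb := (@lebesgue_measure R).
Local Open Scope ereal_scope.

Let shift (h : R) : measurableTypeR R -> measurableTypeR R := fun x => (x + h)%R.

Let measurable_shift (h : R) : measurable_fun setT (shift h).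
Proof. exact: measurable_funD. Qed.

Lemma lebesgue_measure_shift (h : R) (A : set R) : measurable A ->
  pushforward leb (shift h) A = leb A.
Proof.
move=> mA.
pose nu := measure_function_pushforward__canonical__measure_function_Measure
  leb (measurable_shift h).
apply/esym/(lebesgue_measure_unique (mu := nu)) => //= _ [[a b]] _ <-.
rewrite /nu /pushforward /=.
have -> : shift h @^-1` [set` `]a, b] ] = [set` `](a - h)%R, (b - h)%R] ].
  by apply/seteqP; split=> x /=; rewrite /shift !in_itv/= ltrBlDr lerBrDr.
rewrite !lebesgue_measure_itv/= !lte_fin ltrD2r; case: ifP => // _.
by rewrite -!EFinB opprB addrA subrK.
Qed.

Lemma ge0_integral_lebesgue_shift (h : R) (F : R -> \bar R) :
  measurable_fun setT F -> (forall x, 0 <= F x) ->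
  \int[leb]_x F (x + h)%R =\int[leb]_x F x.
Proof.
move=> mF F0.
have <- := ge0_integral_pushforward (measurable_shift h) leb measurableT mF
  (fun x _ => F0 x).
by apply: eq_measure_integral => //= A mA AS; exact: lebesgue_measure_shift.
Qed.

End lebesgue_translation.

Section integral_rV.
Context {R : realType}.
Local Open Scope ereal_scope.

Lemma ge0_integral_rVS n (F : 'rV[R]_n.+1 -> \bar R) :
  measurable_fun setT F -> (forall x, 0 <= F x) ->
  \int[lebesgue_rV n.+1]_z F z =
  \int[lebesgue_measure]_a \int[lebesgue_rV n]_x F (rV_cons (a, x)).
Proof.
move=> mF F0 /=; rewrite ge0_integral_pushforward//; last exact: measurable_rV_cons.
rewrite fubini_tonelli1//; last by move=> x; exact: F0.
by apply: measurableT_comp => //; exact: measurable_rV_cons.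
Qed.

Lemma measurable_rVD d (T : measurableType d) n (f g : T -> 'rV[R]_n) :
  measurable_fun setT f -> measurable_fun setT g ->
  measurable_fun setT (fun x => f x + g x)%R.
Proof.
move=> mf mg; apply: measurable_fun_rVP => i.
under eq_fun do rewrite mxE.
apply: measurable_funD.
- exact: measurableT_comp (@measurable_rV_coord _ _ n i) mf.
- exact: measurableT_comp (@measurable_rV_coord _ _ n i) mg.
Qed.

Lemma measurable_rVN d (T : measurableType d) n (f : T -> 'rV[R]_n) :
  measurable_fun setT f -> measurable_fun setT (fun x => - f x)%R.
Proof.
move=> mf; apply: measurable_fun_rVP => i.
under eq_fun do rewrite mxE.
apply: measurable_funN.
exact: measurableT_comp (@measurable_rV_coord _ _ n i) mf.
Qed.

Lemma measurable_rVB d (T : measurableType d) n (f g : T -> 'rV[R]_n) :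
  measurable_fun setT f -> measurable_fun setT g ->
  measurable_fun setT (fun x => f x - g x)%R.
Proof. by move=> mf mg; apply: measurable_rVD => //; exact: measurable_rVN. Qed.

Lemma rV_consK n (z : 'rV[R]_n.+1) :
  rV_cons (z ord0 ord0, \row_i z ord0 (lift ord0 i)) = z.
Proof.
apply/rowP => i; case: (unliftP ord0 i) => [j|] ->.
- by rewrite rV_consS mxE.
- by rewrite rV_cons0.
Qed.

Lemma rV_consD n (a b : R) (x y : 'rV[R]_n) :
  rV_cons ((a + b)%R, (x + y)%R) = (rV_cons (a, x) + rV_cons (b, y))%R.
Proof.
apply/rowP => i; rewrite [RHS]mxE; case: (unliftP ord0 i) => [j|] ->.
- by rewrite !rV_consS mxE.
- by rewrite !rV_cons0.
Qed.

(** Induction on the dimension: Tonelli separates the first coordinate, which is handled by the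
    one-dimensional shift, from the remaining ones, handled by the induction hypothesis. In
    dimension 0 all row vectors coincide. *)
Lemma ge0_integral_rV_shift n (h : 'rV[R]_n) (F : 'rV[R]_n -> \bar R) :
  measurable_fun setT F -> (forall x, 0 <= F x) ->
  \int[lebesgue_rV n]_x F (x + h)%R = \int[lebesgue_rV n]_x F x.
Proof.
elim: n => [|n ih] in h F *.
  by move=> mF F0; apply: eq_integral => x _; rewrite [x]thinmx0 [h]thinmx0 addr0.
move=> mF F0; rewrite !ge0_integral_rVS//; last first.
  by apply: measurableT_comp => //; apply: measurable_rVD.
set h' := \row_i h ord0 (lift ord0 i).
transitivity (\int[lebesgue_measure]_a
    \int[lebesgue_rV n]_x F (rV_cons ((a + h ord0 ord0)%R, x))).
  apply: eq_integral => a _.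
  rewrite -[RHS](ih h')//=.
    apply: eq_integral => x _; congr F.
    by rewrite rV_consD rV_consK.
  apply: measurableT_comp => //; apply: measurableT_comp => //.
    exact: measurable_rV_cons.
rewrite (ge0_integral_lebesgue_shift _
  (F := fun a => \int[lebesgue_rV n]_x F (rV_cons (a, x))))//.
- apply: (@measurable_fun_fubini_tonelli_F _ _ _ _ R (lebesgue_rV n)
    (fun z => F (rV_cons z))) => //.
  by apply: measurableT_comp => //; exact: measurable_rV_cons.
- by move=> a; apply: integral_ge0.
Qed.

End integral_rV.

(** * Averages against the exponential kernel *)

Section norm1.
Context {R : realType} {n : nat}.
Implicit Types (x y u h : 'rV[R]_n) (c : R).

(** With the l1 norm, exp(- c |u|) is a product of one-dimensional exponentials, so its mass can be
    computed one coordinate at a time. *)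
Definition norm1 u : R := \sum_i `|u ord0 i|.

Lemma norm1_ge0 u : 0 <= norm1 u.
Proof. exact: sumr_ge0. Qed.

Lemma norm1N u : norm1 (- u) = norm1 u.
Proof. by apply: eq_bigr => i _; rewrite mxE normrN. Qed.

Lemma norm1_distC x y : norm1 (x - y) = norm1 (y - x).
Proof. by rewrite -norm1N opprB. Qed.

Lemma norm1D x y : norm1 (x + y) <= norm1 x + norm1 y.
Proof.
by rewrite -big_split; apply: ler_sum => i _; rewrite mxE; exact: ler_normD.
Qed.

Lemma norm1_eq0 u : norm1 u = 0 -> u = 0.
Proof.
move=> /eqP; rewrite psumr_eq0// => /allP u0; apply/rowP => i; rewrite mxE.
by apply/eqP; rewrite -normr_eq0; apply: u0; rewrite mem_index_enum.
Qed.

Lemma coord_le_norm1 u i : `|u ord0 i| <= norm1 u.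
Proof. by rewrite /norm1 (bigD1 i)//= lerDl sumr_ge0. Qed.

Lemma euclidean_norm_le_norm1 u : euclidean_norm u <= norm1 u.
Proof.
rewrite -(ger0_norm (norm1_ge0 u)) -sqrtr_sqr ler_sqrt ?sqr_ge0//.
rewrite expr2 {1}/norm1 mulr_suml; apply: ler_sum => i _.
rewrite -real_normK ?num_real// expr2.
by apply: ler_wpM2l => //; exact: coord_le_norm1.
Qed.

Lemma coord_le_euclidean_norm u i : `|u ord0 i| <= euclidean_norm u.
Proof.
rewrite -sqrtr_sqr ler_sqrt; last by apply: sumr_ge0 => j _; exact: sqr_ge0.
by rewrite (bigD1 i)//= lerDl; apply: sumr_ge0 => j _; exact: sqr_ge0.
Qed.

Lemma norm1_le_euclidean_norm u : norm1 u <= n%:R * euclidean_norm u.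
Proof.
rewrite -[n in n%:R]card_ord -sumr_const mulr_suml.
by apply: ler_sum => i _; rewrite mul1r; exact: coord_le_euclidean_norm.
Qed.

Lemma euclidean_norm_ge0 u : 0 <= euclidean_norm u.
Proof. exact: sqrtr_ge0. Qed.

Lemma measurable_norm1 d (T : measurableType d) (f : T -> 'rV[R]_n) :
  measurable_fun setT f -> measurable_fun setT (norm1 \o f).
Proof.
move=> mf; apply: measurable_sum => i.
apply: measurableT_comp => //.
exact: measurableT_comp (@measurable_rV_coord _ _ n i) mf.
Qed.

(** The product of n Laplace densities of rate c; the factor (c / 2)^n normalises the mass to 1. *)
Definition expkernel c u : R := (c / 2) ^+ n * expR (- (c * norm1 u)).

Lemma expkernelE c u :
  expkernel c u = (c / 2) ^+ n * expR (- (c * norm1 u)).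
Proof. by []. Qed.

Lemma expkernel_gt0 c u : 0 < c -> 0 < expkernel c u.
Proof. by move=> c0; rewrite mulr_gt0 ?expR_gt0 ?exprn_gt0 ?divr_gt0. Qed.

Lemma expkernel_le c u : 0 < c -> expkernel c u <= (c / 2) ^+ n.
Proof.
move=> c0; rewrite ler_piMr ?exprn_ge0 ?divr_ge0 ?(ltW c0)//.
by rewrite -expR0 ler_expR oppr_le0 mulr_ge0 ?norm1_ge0 ?ltW.
Qed.

(** The triangle inequality in the exponent. The factor depends on h only, so integrating it against
    any nonnegative f compares averages at different points. *)
Lemma expkernelD c u h : 0 < c ->
  expkernel c (u + h) <= expR (c * norm1 h) * expkernel c u.
Proof.
move=> c0; rewrite /expkernel mulrCA ler_pM2l ?exprn_gt0 ?divr_gt0//.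
rewrite -expRD ler_expR.
have le_u : norm1 u <= norm1 (u + h) + norm1 h.
  by have := norm1D (u + h) (- h); rewrite addrK norm1N.
have := ler_wpM2l (ltW c0) le_u; rewrite mulrDr; lra.
Qed.

Lemma measurable_expkernel c d (T : measurableType d) (f : T -> 'rV[R]_n) :
  measurable_fun setT f -> measurable_fun setT (expkernel c \o f).
Proof.
move=> mf; apply: measurable_funM; first exact: measurable_cst.
apply: measurableT_comp => //; apply: measurable_funN.
apply: measurable_funM; first exact: measurable_cst.
exact: measurable_norm1.
Qed.

End norm1.

Lemma norm1_cons {R : realType} n (z : R * 'rV[R]_n) :
  norm1 (rV_cons z) = `|z.1| + norm1 z.2.
Proof.
rewrite /norm1 big_ord_recl rV_cons0; congr (_ + _).
by apply: eq_bigr => i _; rewrite rV_consS.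
Qed.

Lemma ge0_integralZl_real d (T : measurableType d) (R : realType)
    (mu : {measure set T -> \bar R}) (D : set T) (f : T -> R) (k : R) :
  measurable D -> measurable_fun D f -> (forall x, 0 <= f x) -> 0 <= k ->
  (\int[mu]_(x in D) (k * f x)%:E = k%:E * \int[mu]_(x in D) (f x)%:E)%E.
Proof.
move=> mD mf f0 k0; under eq_integral do rewrite EFinM.
rewrite ge0_integralZl//.
- exact/measurable_EFinP.
- by move=> x _; rewrite lee_fin.
Qed.

Section expkernel_integral.
Context {R : realType}.
Local Open Scope ereal_scope.

Lemma integral_expR_normr (c : R) : (0 < c)%R ->
  \int[lebesgue_measure]_a (expR (- (c * `|a|)))%:E = (2 / c)%:E.
Proof.
move=> c0; have mexp : measurable_fun setT (fun x : R => expR (- (c * `|x|))).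
  apply: measurableT_comp => //; apply: measurable_funN.
  by apply: measurable_funM => //; exact: measurable_cst.
rewrite ge0_symfun_integralT.
- rewrite -set_itvcy.
  have := integral_exponential_pdf c0.
  have -> : \int[lebesgue_measure]_x (exponential_pdf c x)%:E =
    \int[lebesgue_measure]_(x in `[0%R, +oo[) (c * expR (- (c * `|x|)))%:E.
    rewrite [RHS]integral_mkcond; apply: eq_integral => x _.
    rewrite /exponential_pdf /patch; case: ifPn => //.
    by rewrite inE/= in_itv/= andbT => x0; rewrite ger0_norm// mulNr.
  rewrite ge0_integralZl_real//.
  (* The integral I is known only through c * I = 1 in the extended reals; an infinite I would make
     the left-hand side infinite. *)
  + case: integral => [r| |].
    * move=> [/(congr1 (fun x => c^-1 * x)%R)].
      by rewrite mulKf ?gt_eqF// mulr1 => ->; rewrite EFinM.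
    * by rewrite gt0_muley// lte_fin.
    * by rewrite gt0_muleNy// lte_fin.
  + exact: measurable_funTS.
  + exact: ltW.
- by move=> x; rewrite expR_ge0.
- move=> x; apply: continuous_comp; last exact: continuous_expR.
  apply: cvgN; apply: cvgM; first exact: cvg_cst.
  by apply: cvg_norm; exact: cvg_id.
- by move=> x /=; rewrite normrN.
Qed.

Lemma measurable_expR_norm1 n (c : R) d (T : measurableType d)
    (f : T -> 'rV[R]_n) : measurable_fun setT f ->
  measurable_fun setT (fun x => expR (- (c * norm1 (f x)))).
Proof.
move=> mf; apply: measurableT_comp => //; apply: measurable_funN.
by apply: measurable_funM; [exact: measurable_cst|exact: measurable_norm1].
Qed.

Lemma integral_expR_norm1 n (c : R) : (0 < c)%R ->
  \int[lebesgue_rV n]_u (expR (- (c * norm1 u)))%:E = ((2 / c) ^+ n)%:E.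
Proof.
move=> c0; elim: n => [|n ih].
  rewrite integral_dirac//= ?diracT ?mul1e; last first.
    exact/measurable_EFinP/measurable_expR_norm1.
  by rewrite /norm1 big_ord0 mulr0 oppr0 expR0 expr0.
rewrite ge0_integral_rVS.
- transitivity (\int[lebesgue_measure]_a
     ((2 / c) ^+ n * (expR (- (c * `|a|))))%:E).
    apply: eq_integral => a _.
    under eq_integral do rewrite norm1_cons/= mulrDr opprD expRD.
    rewrite ge0_integralZl_real ?ih -1?EFinM 1?mulrC//.
    exact: measurable_expR_norm1.
  rewrite ge0_integralZl_real//.
  + by rewrite integral_expR_normr// -EFinM exprSr.
  + apply: measurableT_comp => //.
    by apply: measurable_funN; apply: measurable_funM => //; exact: measurable_cst.
  + by rewrite exprn_ge0// divr_ge0// ltW.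
- exact/measurable_EFinP/measurable_expR_norm1.
- by move=> x; rewrite lee_fin expR_ge0.
Qed.

Lemma integral_expkernel n (c : R) : (0 < c)%R ->
  \int[lebesgue_rV n]_u (expkernel c u)%:E = 1.
Proof.
move=> c0; rewrite /expkernel ge0_integralZl_real//.
- rewrite integral_expR_norm1// -EFinM -exprMn mulrA divfK//.
  by rewrite divff ?gt_eqF// expr1n.
- exact: measurable_expR_norm1.
- by rewrite exprn_ge0// divr_ge0// ltW.
Qed.

End expkernel_integral.

Opaque expkernel.

(** * Elementary inequalities for real powers *)

Section powR_inequalities.
Context {R : realType}.
Implicit Types a b e p s t x : R.

Lemma ler_powR2r p x y : 0 <= p -> 0 <= x -> x <= y -> x `^ p <= y `^ p.
Proof.
move=> p0 x0 xy; apply: ge0_ler_powR => //; rewrite nnegrE//.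
exact: le_trans xy.
Qed.

(** If a > e then a <= a * (a / e)^(p - 1). The free parameter e trades a small constant against a
    large multiple of a^p; this replaces Hoelder in bounding averages by the L^p norm. *)
Lemma le_add_powR a e p : 0 <= a -> 0 < e -> 1 <= p ->
  a <= e + e `^ (1 - p) * a `^ p.
Proof.
move=> a0 e0 p1; have [ae|ea] := leP a e.
  by rewrite (le_trans ae)// lerDl mulr_ge0 ?powR_ge0.
apply: (@le_trans _ _ (e `^ (1 - p) * a `^ p)); last by rewrite lerDr ltW.
rewrite -(mulr_powRB1 a0); last lra.
rewrite mulrCA; suff : 1 <= e `^ (1 - p) * a `^ (p - 1).
  by move=> /(ler_wpM2l a0); rewrite mulr1.
have eK : e `^ (1 - p) * e `^ (p - 1) = 1.
  rewrite -powRD ?(gt_eqF e0) ?implybT//.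
  by rewrite (_ : 1 - p + (p - 1) = 0) ?powRr0//; ring.
apply: (@le_trans _ _ (e `^ (1 - p) * e `^ (p - 1))); first by rewrite eK.
rewrite ler_wpM2l ?powR_ge0//; apply: ler_powR2r; [lra|exact: ltW|exact: ltW].
Qed.

Lemma powRD_le a b p : 0 <= a -> 0 <= b -> 0 <= p ->
  (a + b) `^ p <= 2 `^ p * (a `^ p + b `^ p).
Proof.
move=> a0 b0 p0; wlog ab : a b a0 b0 / a <= b.
  move=> h; case/orP: (le_total a b) => ab; first exact: h.
  by rewrite addrC (addrC (a `^ p)); exact: h.
apply: (@le_trans _ _ ((2 * b) `^ p)).
  by apply: ler_powR2r => //; [exact: addr_ge0|lra].
by rewrite powRM// ler_wpM2l ?powR_ge0// lerDr powR_ge0.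
Qed.

(** The inequality x <= exp x at x = c * t / s, raised to the power s. *)
Lemma powR_le_expR s t c : 0 < s -> 0 <= t -> 0 < c ->
  t `^ s <= (s / c) `^ s * expR (c * t).
Proof.
move=> s0 t0 c0.
have -> : c * t = c * t / s * s by rewrite divfK// gt_eqF.
rewrite expRM -powRM ?expR_ge0 ?divr_ge0 ?(ltW s0) ?(ltW c0)//.
apply: ler_powR2r => //; first exact: ltW.
have tE : t = s / c * (c * t / s) by field; rewrite !gt_eqF.
rewrite [leLHS]tE ler_wpM2l ?divr_ge0 ?(ltW s0) ?(ltW c0)//.
have := expR_ge1Dx (c * t / s); lra.
Qed.

End powR_inequalities.

Lemma measurable_powRr_comp (R : realType) d (T : measurableType d)
    (g : T -> R) (r : R) :
  measurable_fun setT g -> measurable_fun setT (fun x => g x `^ r).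
Proof. by move=> mg; exact: (@measurableT_comp _ _ _ _ _ _ (@powR R ^~ r)). Qed.

(** * Jensen's inequality for powers *)

Section jensen.
Context d (T : measurableType d) (R : realType) (mu : {measure set T -> \bar R}).
Local Open Scope ereal_scope.

(** Hoelder applied to k^(1/q) and k^(1/p) * a with q conjugate to p; the first factor has norm 1
    because k has mass 1. *)
Lemma integral_weighted_powR (k a : T -> R) (p : R) :
  (1 < p)%R -> measurable_fun setT k -> measurable_fun setT a ->
  (forall x, 0 <= k x)%R -> (forall x, 0 <= a x)%R ->
  \int[mu]_x (k x)%:E = 1 ->
  (\int[mu]_x (k x * a x)%:E) `^ p <= \int[mu]_x (k x * a x `^ p)%:E.
Proof.
move=> p1 mk ma k0 a0 k1.
have p0 : (0 < p)%R by lra.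
pose q := (p / (p - 1))%R.
have q0 : (0 < q)%R by rewrite divr_gt0// subr_gt0.
have pq : (q^-1 + p^-1 = 1)%R by rewrite /q; field; rewrite !gt_eqF// subr_gt0.
have := hoelder mu (measurable_powRr_comp q^-1 mk)
  (measurable_funM (measurable_powRr_comp p^-1 mk) ma) q0 p0 pq.
rewrite Lnorm1 => h.
have {}h : \int[mu]_x (k x * a x)%:E <= (\int[mu]_x (k x * a x `^ p)%:E) `^ p^-1.
  apply: le_trans (le_trans h _).
    rewrite le_eqVlt; apply/orP; left; apply/eqP; apply: eq_integral => x _ /=.
    rewrite mulrA -powRD ?pq ?oner_eq0// powRr1// ger0_norm//.
    by rewrite mulr_ge0.
  rewrite unlock /= (_ : \int[mu]_x _ = 1); last first.
    rewrite -k1; apply: eq_integral => x _ /=.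
    rewrite ger0_norm ?powR_ge0// -powRrM mulVf ?gt_eqF// powRr1//.
  rewrite poweR1r mul1e le_eqVlt; apply/orP; left; apply/eqP; congr (_ `^ _).
  apply: eq_integral => x _ /=.
  rewrite ger0_norm ?mulr_ge0 ?powR_ge0// powRM ?powR_ge0//.
  by rewrite -powRrM mulVf ?gt_eqF// powRr1.
rewrite (le_trans (gt0_ler_poweR (ltW p0) _ _ h))//.
- rewrite in_itv/= leey andbT; apply: integral_ge0 => x _.
  by rewrite lee_fin mulr_ge0.
- by rewrite in_itv/= leey poweR_ge0.
- rewrite -poweRrM mulVf ?gt_eqF// poweRe1//.
  by apply: integral_ge0 => x _; rewrite lee_fin mulr_ge0// powR_ge0.
Qed.

End jensen.

Section averages.
Context {R : realType} {n : nat}.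
Implicit Types (f : 'rV[R]_n -> R) (x y h u : 'rV[R]_n) (c p : R).
Local Notation mu := (lebesgue_rV n).

(** The integral is real-valued and is sent to 0 when infinite, hence the integrability lemmas that
    precede the comparisons below. *)
Definition kernel_average c f x : R :=
  \int[mu]_y (expkernel c (y - x) * f y).

Definition kernel_oscillation c f x : R :=
  \int[mu]_y (expkernel c (y - x) * `|f y - f x|).

Local Open Scope ereal_scope.

Lemma measurable_expkernelB c x :
  measurable_fun setT (fun y => expkernel c (y - x)).
Proof.
apply: (@measurable_expkernel _ _ c _ _ (fun y => y - x)%R).
exact: measurable_rVB.
Qed.

Lemma integral_expkernelB c x : (0 < c)%R ->
  \int[mu]_y (expkernel c (y - x))%:E = 1.
Proof.
move=> c0; rewrite -(integral_expkernel n c0).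
rewrite -[RHS](ge0_integral_rV_shift (- x)%R)//.
- apply/measurable_EFinP.
  exact: (@measurable_expkernel R n c _ _ _ (@measurable_id _ _ _)).
- by move=> y; rewrite lee_fin ltW// expkernel_gt0.
Qed.

Lemma integrable_expkernelB c x : (0 < c)%R ->
  mu.-integrable setT (EFin \o (fun y => expkernel c (y - x))).
Proof.
move=> c0; apply/integrableP; split.
  by apply/measurable_EFinP; exact: measurable_expkernelB.
under eq_integral => y _ do
  rewrite /= (ger0_norm (ltW (expkernel_gt0 _ c0))).
by rewrite integral_expkernelB// ltry.
Qed.

Section powR_integrable.
Variables (p : R) (f : 'rV[R]_n -> R) (P : R).
Hypotheses (p1 : (1 < p)%R) (mf : measurable_fun setT f).
Hypothesis fP : \int[mu]_y (`|f y| `^ p)%:E = P%:E.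

(** [le_add_powR] under the integral: the kernel has mass 1 against the constant e and is at most (c
    / 2)^n against |f|^p. With e = 1 this gives integrability; with small e and c it gives the decay
    of the heat extension at large times. *)
Lemma integral_kernel_normr_le c x (e : R) : (0 < c)%R -> (0 < e)%R ->
  \int[mu]_y (expkernel c (y - x) * `|f y|)%:E <=
  (e + e `^ (1 - p) * ((c / 2) ^+ n * P))%:E.
Proof.
move=> c0 e0.
have mfp : measurable_fun setT (fun y => `|f y| `^ p)%R.
  apply: (@measurableT_comp _ _ _ _ _ _ (@powR R ^~ p)) => //.
  exact: measurableT_comp.
have k0 y : (0 <= expkernel c (y - x))%R by rewrite ltW// expkernel_gt0.
have ep0 : (0 <= e `^ (1 - p) * (c / 2) ^+ n)%R.
  by rewrite mulr_ge0 ?powR_ge0// exprn_ge0// divr_ge0// ltW.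
apply: (@le_trans _ _ (\int[mu]_y ((e * expkernel c (y - x))%:E +
    (e `^ (1 - p) * (c / 2) ^+ n * (`|f y| `^ p))%:E))).
- apply: ge0_le_integral => //.
  + by move=> y _; rewrite lee_fin mulr_ge0.
  + apply/measurable_EFinP; apply: measurable_funM.
      exact: measurable_expkernelB.
    exact: measurableT_comp.
  + apply: emeasurable_funD; apply/measurable_EFinP; apply: measurable_funM => //.
    exact: measurable_expkernelB.
  + move=> y _; rewrite -EFinD lee_fin.
    apply: (@le_trans _ _ (expkernel c (y - x) *
        (e + e `^ (1 - p) * `|f y| `^ p)))%R.
      by rewrite ler_wpM2l// le_add_powR// ltW.
    rewrite mulrDr mulrC lerD2l mulrCA -mulrA ler_wpM2l ?powR_ge0//.
    by rewrite ler_wpM2r ?powR_ge0// expkernel_le.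
- rewrite ge0_integralD//.
  + rewrite (@ge0_integralZl_real _ _ _ _ _ (fun y => expkernel c (y - x))%R)//.
    * rewrite (@ge0_integralZl_real _ _ _ _ _ (fun y => `|f y| `^ p)%R)//.
      by rewrite integral_expkernelB// fP mule1 -EFinM -EFinD mulrA.
    * exact: measurable_expkernelB.
    * exact: ltW.
  + by move=> y _; rewrite lee_fin mulr_ge0// ltW.
  + apply/measurable_EFinP; apply: measurable_funM => //.
    exact: measurable_expkernelB.
  + by move=> y _; rewrite lee_fin mulr_ge0// powR_ge0.
  + by apply/measurable_EFinP; apply: measurable_funM.
Qed.

Lemma integrable_kernelM c x : (0 < c)%R ->
  mu.-integrable setT (EFin \o (fun y => expkernel c (y - x) * f y)%R).
Proof.
move=> c0; apply/integrableP; split.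
  apply/measurable_EFinP; apply: measurable_funM => //.
  exact: measurable_expkernelB.
under eq_integral => y _ do
  rewrite /= normrM (ger0_norm (ltW (expkernel_gt0 _ c0))).
by rewrite (le_lt_trans (integral_kernel_normr_le x c0 ltr01))// ltry.
Qed.

Lemma integrable_kernel_oscillation c x : (0 < c)%R ->
  mu.-integrable setT (EFin \o (fun y => expkernel c (y - x) * `|f y - f x|)%R).
Proof.
move=> c0; have := integrableB measurableT (integrable_kernelM x c0)
  (integrableZl measurableT (f x) (integrable_expkernelB x c0)).
move=> /integrable_abse; apply: eq_integrable => // y _ /=.
congr EFin.
by rewrite (mulrC (f x)) -mulrBr normrM (ger0_norm (ltW (expkernel_gt0 _ c0))).
Qed.

End powR_integrable.

End averages.

Section average_estimates.
Context {R : realType} {n : nat}.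
Implicit Types (x y h u : 'rV[R]_n) (c : R).
Local Notation mu := (lebesgue_rV n).
Variables (p : R) (f : 'rV[R]_n -> R) (P : R).
Hypotheses (p1 : 1 < p) (mf : measurable_fun setT f).
Hypothesis fP : (\int[mu]_y (`|f y| `^ p)%:E = P%:E)%E.

Let iK c x := integrable_expkernelB (n := n) (c := c) x.
Let iA c x (c0 : 0 < c) := integrable_kernelM p1 mf fP x c0.
Let iQ c x (c0 : 0 < c) := integrable_kernel_oscillation p1 mf fP x c0.

Lemma Rintegral_expkernelB c x : 0 < c ->
  \int[mu]_y expkernel c (y - x) = 1.
Proof. by move=> c0; rewrite /Rintegral integral_expkernelB. Qed.

Lemma kernel_oscillation_ge0 c x : 0 < c -> 0 <= kernel_oscillation c f x.
Proof.
by move=> c0; apply: Rintegral_ge0 => y _; rewrite mulr_ge0// ltW// expkernel_gt0.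
Qed.

Lemma integrable_kernelM_cst c x (a : R) : 0 < c ->
  mu.-integrable setT (EFin \o (fun y => expkernel c (y - x) * a)).
Proof.
move=> c0; have := integrableZr measurableT a (iK x c0).
by apply: eq_integrable.
Qed.

Lemma Rintegral_kernelM_cst c x (a : R) : 0 < c ->
  \int[mu]_y (expkernel c (y - x) * a) = a.
Proof.
by move=> c0; rewrite RintegralZr ?Rintegral_expkernelB ?mul1r//; exact: iK.
Qed.

Let iB c z (a : R) (c0 : 0 < c) : mu.-integrable setT
  (EFin \o (fun y => expkernel c (y - z) * f y - expkernel c (y - z) * a)).
Proof.
have := integrableB measurableT (iA z c0) (integrable_kernelM_cst z a c0).
exact: eq_integrable.
Qed.

Lemma normr_kernel_averageB_le c x : 0 < c ->
  `|kernel_average c f x - f x| <= kernel_oscillation c f x.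
Proof.
move=> c0; rewrite -{1}(Rintegral_kernelM_cst x (f x) c0).
rewrite -RintegralB//; [|exact: iA|exact: integrable_kernelM_cst].
apply: le_trans (le_normr_Rintegral _ _) _ => //.
  exact: iB.
rewrite le_eqVlt; apply/orP; left; apply/eqP; apply: eq_Rintegral => y _.
by rewrite -mulrBr normrM (ger0_norm (ltW (expkernel_gt0 _ c0))).
Qed.

(** The upper bound is [expkernelD]. For the lower one, translating back gives the factor exp(- z)
    with z = c |h|_1, and exp(- z) >= 1 - z >= 2 - exp z. *)
Lemma normr_expkernelB_le c u h : 0 < c ->
  `|expkernel c (u - h) - expkernel c u| <=
  (expR (c * norm1 h) - 1) * expkernel c u.
Proof.
move=> c0; have k0 := expkernel_gt0 u c0.
have z0 : 0 <= c * norm1 h by rewrite mulr_ge0 ?norm1_ge0 ?ltW.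
have := expkernelD u (- h) c0; rewrite norm1N => ub.
have := expkernelD (u - h) h c0; rewrite subrK => lb.
rewrite ler_norml; apply/andP; split; last by rewrite mulrBl mul1r lerD2r.
have eN : expR (- (c * norm1 h)) * expR (c * norm1 h) = 1.
  by rewrite -expRD addNr expR0.
have := ler_wpM2l (expR_ge0 (- (c * norm1 h))) lb.
rewrite [X in _ <= X -> _]mulrA eN mul1r => {}lb.
have := expR_ge1Dx (c * norm1 h); have := expR_ge1Dx (- (c * norm1 h)).
set E := expR (c * norm1 h) in lb ub eN *; set E' := expR _ in lb eN *.
move=> e1 e2; have : (2 - E) * expkernel c u <= E' * expkernel c u.
  by rewrite ler_pM2r//; lra.
by rewrite !mulrBl mul1r; lra.
Qed.

(** Both kernels have mass 1, so f x can be subtracted from f in either average; what remains is the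
    difference of the kernels integrated against f y - f x. *)
Lemma normr_kernel_average_shiftB_le c x h : 0 < c ->
  `|kernel_average c f (x + h) - kernel_average c f x| <=
  (expR (c * norm1 h) - 1) * kernel_oscillation c f x.
Proof.
move=> c0.
have iB1 := iB (x + h) (f x) c0; have iB0 := iB x (f x) c0.
have distr (a b v w : R) : a * v - a * w - (b * v - b * w) = (a - b) * (v - w).
  by ring.
have -> : kernel_average c f (x + h) - kernel_average c f x =
  \int[mu]_y ((expkernel c (y - (x + h)) - expkernel c (y - x)) * (f y - f x)).
  transitivity ((kernel_average c f (x + h) - f x) - (kernel_average c f x - f x)).
    by rewrite opprB addrA subrK.
  have avB z : kernel_average c f z - f x =
      \int[mu]_y (expkernel c (y - z) * f y - expkernel c (y - z) * f x).
    rewrite (RintegralB measurableT (iA z c0) (integrable_kernelM_cst z (f x) c0)).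
    by rewrite Rintegral_kernelM_cst.
  apply: (etrans (congr2 (fun a b => a - b) (avB (x + h)) (avB x))).
  apply: (etrans (esym (RintegralB measurableT iB1 iB0))).
  by apply: eq_Rintegral => y _; exact: distr.
apply: le_trans (le_normr_Rintegral _ _) _ => //.
  have := integrableB measurableT iB1 iB0.
  by apply: eq_integrable => // y _ /=; congr EFin; exact: distr.
rewrite -RintegralZl//; last exact: iQ.
apply: le_Rintegral => //.
- have := integrable_abse (integrableB measurableT iB1 iB0).
  by apply: eq_integrable => // y _ /=; congr EFin; congr (`|_|); exact: distr.
- have := integrableZl measurableT (expR (c * norm1 h) - 1) (iQ x c0).
  exact: eq_integrable.
- move=> y _; rewrite normrM mulrA ler_wpM2r//.
  by rewrite opprD addrA; exact: normr_expkernelB_le.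
Qed.

Section nonneg.
Hypothesis f0 : forall x, 0 <= f x.

Lemma kernel_average_ge0 c x : 0 < c -> 0 <= kernel_average c f x.
Proof.
by move=> c0; apply: Rintegral_ge0 => y _; rewrite mulr_ge0// ltW// expkernel_gt0.
Qed.

Lemma kernel_average_le c x (e : R) : 0 < c -> 0 < e ->
  kernel_average c f x <= e + e `^ (1 - p) * ((c / 2) ^+ n * P).
Proof.
move=> c0 e0; rewrite -lee_fin /kernel_average /Rintegral fineK.
  apply: le_trans (integral_kernel_normr_le p1 mf fP x c0 e0).
  rewrite le_eqVlt; apply/orP; left; apply/eqP; apply: eq_integral => y _.
  by rewrite ger0_norm.
by apply: integrable_fin_num => //; exact: iA.
Qed.

Lemma kernel_average_shift_le c x h : 0 < c ->
  kernel_average c f (x + h) <= expR (c * norm1 h) * kernel_average c f x.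
Proof.
move=> c0; rewrite -RintegralZl//; last exact: iA.
apply: le_Rintegral => //; first exact: iA.
- have := integrableZl measurableT (expR (c * norm1 h)) (iA x c0).
  exact: eq_integrable.
- move=> y _; rewrite mulrA ler_wpM2r// opprD addrA.
  by have := expkernelD (y - x) (- h) c0; rewrite norm1N.
Qed.

(* Outside the [norm1]-ball of radius r the kernel at scale c is at most
   (c / c1)^n exp(- (c - c1) r) times the kernel at scale c1. *)
Lemma kernel_average_le_near c c1 x (M r : R) : 0 < c1 -> c1 <= c -> 0 <= M ->
  (forall y, norm1 (y - x) <= r -> f y <= M) ->
  kernel_average c f x <=
  M + (c / c1) ^+ n * expR (- ((c - c1) * r)) * kernel_average c1 f x.
Proof.
move=> c10 c1c M0 fM; have c0 : 0 < c by exact: lt_le_trans c1c.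
set D := _ * expR _.
rewrite -[X in X + _](Rintegral_kernelM_cst x M c0).
rewrite -RintegralZl//; last exact: iA.
have iD : mu.-integrable setT
    (EFin \o (fun y => D * (expkernel c1 (y - x) * f y))).
  by have := integrableZl measurableT D (iA x c10); exact: eq_integrable.
rewrite -RintegralD//; last exact: integrable_kernelM_cst.
apply: le_Rintegral => //; first exact: iA.
  have := integrableD measurableT (integrable_kernelM_cst x M c0) iD.
  exact: eq_integrable.
have D0 : 0 <= D.
  by rewrite mulr_ge0 ?expR_ge0// exprn_ge0// divr_ge0// ltW.
have k0 := expkernel_gt0 _ c0.
have k10 := expkernel_gt0 _ c10.
move=> y _; have [yr|ry] := leP (norm1 (y - x)) r.
  rewrite -[leLHS]addr0; apply: lerD.
    by apply: ler_wpM2l; [exact: ltW|exact: fM].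
  by rewrite mulr_ge0// mulr_ge0// ltW.
rewrite -[leLHS]add0r; apply: lerD; first by rewrite mulr_ge0// ltW.
rewrite mulrA ler_wpM2r//.
rewrite /D !expkernelE mulrACA -exprMn; apply: ler_pM => //.
- by rewrite exprn_ge0// divr_ge0// ltW.
- by rewrite -mulrA [c1 / 2 in leRHS]mulrC (mulrA c1^-1) (mulrC c1^-1) divfK ?gt_eqF.
- rewrite -expRD ler_expR -opprD lerN2.
  have := ler_wpM2l (_ : 0 <= c - c1) (ltW ry); rewrite subr_ge0 => /(_ c1c).
  by rewrite !mulrBl; lra.
Qed.

End nonneg.

End average_estimates.

(** * Decay in L^p of the oscillation at scale c *)

Section oscillation_powR.
Context {R : realType} {n : nat}.
Implicit Types (x y h u : 'rV[R]_n) (c : R).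
Local Notation mu := (lebesgue_rV n).

Lemma measurable_kernel_average (f : 'rV[R]_n -> R) c :
  measurable_fun setT f -> (forall x, 0 <= f x) -> 0 < c ->
  measurable_fun setT (kernel_average c f).
Proof.
move=> mf f0 c0.
apply: (@measurableT_comp _ _ _ _ _ _ fine _
  (fun x => \int[mu]_y (expkernel c (y - x) * f y)%:E)%E) => //.
apply: (@measurable_fun_fubini_tonelli_F _ _ _ _ R mu
  (fun z : 'rV[R]_n * 'rV[R]_n => (expkernel c (z.2 - z.1) * f z.2)%:E)).
- apply/measurable_EFinP; apply: measurable_funM.
    by apply: measurable_expkernel; exact: measurable_rVB.
  exact: measurableT_comp.
- by move=> z; rewrite lee_fin mulr_ge0// ltW// expkernel_gt0.
Qed.

Lemma measurable_kernel_oscillation (f : 'rV[R]_n -> R) c :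
  measurable_fun setT f -> 0 < c ->
  measurable_fun setT (kernel_oscillation c f).
Proof.
move=> mf c0.
apply: (@measurableT_comp _ _ _ _ _ _ fine _
  (fun x => \int[mu]_y (expkernel c (y - x) * `|f y - f x|)%:E)%E) => //.
apply: (@measurable_fun_fubini_tonelli_F _ _ _ _ R mu
  (fun z : 'rV[R]_n * 'rV[R]_n => (expkernel c (z.2 - z.1) * `|f z.2 - f z.1|)%:E)).
- apply/measurable_EFinP; apply: measurable_funM.
    by apply: measurable_expkernel; exact: measurable_rVB.
  apply: measurableT_comp => //; apply: measurable_funB; exact: measurableT_comp.
- by move=> z; rewrite lee_fin mulr_ge0// ltW// expkernel_gt0.
Qed.

(** Half of the exponent absorbs the growth of |u|^s at the price c^(- s), and the other half is the
    kernel of rate c / 2; 2^n corrects its normalisation. *)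
Lemma expkernelM_norm1_le c u (s : R) : 0 < c -> 0 < s ->
  expkernel c u * norm1 u `^ s <=
  (2 * s) `^ s * 2 ^+ n * c `^ (- s) * expkernel (c / 2) u.
Proof.
move=> c0 s0; rewrite !expkernelE.
have c20 : 0 < c / 2 by rewrite divr_gt0.
have := powR_le_expR s0 (norm1_ge0 u) c20.
have -> : (s / (c / 2)) `^ s = (2 * s) `^ s * c `^ (- s).
  have -> : c `^ (- s) = c^-1 `^ s.
    by rewrite -(powR_inv1 (ltW c0)) -powRrM mulN1r.
  rewrite -powRM ?invr_ge0 ?mulr_ge0 ?(ltW c0) ?(ltW s0)//.
  by congr (_ `^ _); field; rewrite gt_eqF.
move=> /(ler_wpM2l (expR_ge0 (- (c * norm1 u)))).
have c2n0 : 0 <= (c / 2) ^+ n by rewrite exprn_ge0// ltW.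
move=> /(ler_wpM2l c2n0); rewrite mulrA => /le_trans; apply.
have -> : (c / 2) ^+ n = 2 ^+ n * (c / 2 / 2) ^+ n.
  by rewrite -exprMn; congr (_ ^+ _); field.
have <- : expR (- (c * norm1 u)) * expR (c / 2 * norm1 u) =
    expR (- (c / 2 * norm1 u)).
  by rewrite -expRD; congr expR; field.
by rewrite le_eqVlt; apply/orP; left; apply/eqP; ring.
Qed.

Local Open Scope ereal_scope.

Variables (p : R) (f : 'rV[R]_n -> R) (P : R).
Hypotheses (p1 : (1 < p)%R) (mf : measurable_fun setT f).
Hypothesis fP : \int[mu]_y (`|f y| `^ p)%:E = P%:E.

(** Jensen brings the power inside the average, the substitution y = x + u and Tonelli put the
    integral in x innermost, and [fB] bounds that integral by |u|^s * B. The kernel then turns |u|^s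
    into c^(- s). The exponent s stands for alpha p. *)
Lemma integral_kernel_oscillation_powR c (s B : R) :
  (0 < c)%R -> (0 < s)%R -> (0 <= B)%R ->
  (forall u, \int[mu]_x (`|f (x + u) - f x| `^ p)%:E <= (norm1 u `^ s * B)%:E) ->
  \int[mu]_x (kernel_oscillation c f x `^ p)%:E <=
  ((2 * s) `^ s * 2 ^+ n * c `^ (- s) * B)%:E.
Proof.
move=> c0 s0 B0 fB.
have k0 u : (0 <= expkernel c u)%R by rewrite ltW// expkernel_gt0.
have mdiff : measurable_fun setT
    (fun z : 'rV[R]_n * 'rV[R]_n => (`|f z.2 - f z.1| `^ p)%R).
  apply: measurable_powRr_comp; apply: measurableT_comp => //.
  by apply: measurable_funB; exact: measurableT_comp.
have mshift : measurable_fun setT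
    (fun z : 'rV[R]_n * 'rV[R]_n => (`|f (z.1 + z.2) - f z.1| `^ p)%R).
  apply: measurable_powRr_comp; apply: measurableT_comp => //.
  apply: measurable_funB; apply: measurableT_comp => //.
  exact: measurable_rVD.
have mker : measurable_fun setT (fun z : 'rV[R]_n * 'rV[R]_n =>
    expkernel c z.2) by exact: measurable_expkernel.
have intK : \int[mu]_u
    ((2 * s) `^ s * 2 ^+ n * c `^ (- s) * B * expkernel (c / 2) u)%:E =
    ((2 * s) `^ s * 2 ^+ n * c `^ (- s) * B)%:E.
  rewrite ge0_integralZl_real ?integral_expkernel ?mule1 ?divr_gt0//;
    [exact: measurable_expkernel|
     by move=> u; rewrite ltW// expkernel_gt0// divr_gt0|
     by rewrite !mulr_ge0 ?powR_ge0].
apply: (@le_trans _ _ (\int[mu]_x \int[mu]_u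
    (expkernel c u * `|f (x + u) - f x| `^ p)%:E)).
- apply: ge0_le_integral => //.
  + by move=> x _; rewrite lee_fin powR_ge0.
  + apply/measurable_EFinP; apply: measurable_powRr_comp.
    exact: measurable_kernel_oscillation.
  + apply: (@measurable_fun_fubini_tonelli_F _ _ _ _ R mu
      (fun z : 'rV[R]_n * 'rV[R]_n =>
        (expkernel c z.2 * `|f (z.1 + z.2) - f z.1| `^ p)%:E)).
      by apply/measurable_EFinP; apply: measurable_funM.
    by move=> z; rewrite lee_fin mulr_ge0// powR_ge0.
  + move=> x _.
    have mx : measurable_fun setT (fun y => `|f y - f x|)%R.
      by apply: measurableT_comp => //; exact: measurable_funB.
    have := integral_weighted_powR p1 (measurable_expkernelB c x) mx
      (fun y => k0 (y - x)%R) (fun y => normr_ge0 _) (integral_expkernelB x c0).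
    rewrite -(fineK (integrable_fin_num measurableT
      (integrable_kernel_oscillation p1 mf fP x c0))) poweR_EFin.
    move=> /le_trans; apply.
    rewrite le_eqVlt; apply/orP; left; apply/eqP.
    rewrite -[LHS](ge0_integral_rV_shift x).
    * by apply: eq_integral => u _; rewrite addrK (addrC u).
    * apply/measurable_EFinP; apply: measurable_funM.
        exact: measurable_expkernelB.
      exact: measurable_powRr_comp.
    * by move=> y; rewrite lee_fin mulr_ge0// powR_ge0.
- rewrite (fubini_tonelli (m1 := mu) (m2 := mu) (fun z : 'rV[R]_n * 'rV[R]_n =>
    (expkernel c z.2 * `|f (z.1 + z.2) - f z.1| `^ p)%:E)).
  + rewrite -intK; apply: ge0_le_integral => //.
    * move=> u _; apply: integral_ge0 => x _.
      by rewrite lee_fin mulr_ge0// powR_ge0.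
    * apply: (@measurable_fun_fubini_tonelli_G _ _ _ _ R mu
        (fun z : 'rV[R]_n * 'rV[R]_n =>
        (expkernel c z.2 * `|f (z.1 + z.2) - f z.1| `^ p)%:E)).
        by apply/measurable_EFinP; apply: measurable_funM.
      by move=> z; rewrite lee_fin mulr_ge0// powR_ge0.
    * apply/measurable_EFinP; apply: measurable_funM => //.
      exact: measurable_expkernel.
    * move=> u _ /=; rewrite ge0_integralZl_real//.
      ** apply: le_trans (lee_wpmul2l _ (fB u)) _; first by rewrite lee_fin.
        rewrite -EFinM lee_fin mulrA [leRHS]mulrAC.
        by rewrite ler_wpM2r// expkernelM_norm1_le.
      ** apply: measurable_powRr_comp; apply: measurableT_comp => //.
        apply: measurable_funB => //; apply: measurableT_comp => //.
        by apply: measurable_rVD.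
  + by apply/measurable_EFinP; apply: measurable_funM.
  + by move=> z; rewrite lee_fin mulr_ge0// powR_ge0.
Qed.

End oscillation_powR.

Opaque kernel_average kernel_oscillation.

(** * The dyadic maximal function *)

Section dyadic_sums.
Context {R : realType}.
Implicit Types a s : R.

Let powR2_gt1 s : 0 < s -> 1 < 2 `^ s :> R.
Proof.
move=> s0; have : 1 `^ s < 2 `^ s :> R.
  by apply: gt0_ltr_powR; rewrite ?nnegrE ?ltr1n.
by rewrite powR1.
Qed.

Let powRN_le1 s a : 0 < s -> 1 <= a -> a `^ (- s) <= 1.
Proof.
move=> s0 a1; rewrite powRN invf_le1 ?powR_gt0 ?(lt_le_trans _ a1)//.
have : 1 `^ s <= a `^ s by apply: ler_powR2r => //; exact: ltW.
by rewrite powR1.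
Qed.

Let sum_shift (P : pred R) (F : R -> R) a N :
  \sum_(j < N.+1 | P (a * 2 ^+ j)) F (a * 2 ^+ j) =
  (if P a then F a else 0) + \sum_(j < N | P (2 * a * 2 ^+ j)) F (2 * a * 2 ^+ j).
Proof.
have e (j : nat) : a * 2 ^+ j.+1 = 2 * a * 2 ^+ j by rewrite exprS mulrCA mulrA.
rewrite big_mkcond big_ord_recl /= expr0 mulr1; congr (_ + _).
by rewrite [RHS]big_mkcond; apply: eq_bigr => j _; rewrite /bump /= e.
Qed.

Lemma sum_dyadic_ge1_le a s N : 0 < a -> 0 < s ->
  \sum_(j < N | 1 <= a * 2 ^+ j) (a * 2 ^+ j) `^ (- s) <= (1 - 2 `^ (- s))^-1.
Proof.
move=> a0 s0.
have q1 : 2 `^ (- s) < 1 :> R by rewrite powRN invf_lt1 ?powR_gt0 ?powR2_gt1.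
set K := _^-1; have K0 : 0 < K by rewrite invr_gt0 subr_gt0.
have KE : 1 + K * 2 `^ (- s) = K.
  by rewrite /K; field; rewrite subr_eq0 gt_eqF.
suff h : \sum_(j < N | 1 <= a * 2 ^+ j) (a * 2 ^+ j) `^ (- s) <=
    K * Num.max 1 a `^ (- s).
  by rewrite (le_trans h)// ler_piMr ?(ltW K0)// powRN_le1// le_max lexx.
elim: N a a0 => [|N ih] a a0; first by rewrite big_ord0 mulr_ge0 ?powR_ge0 ?ltW.
rewrite (sum_shift (fun t => 1 <= t) (fun t => t `^ (- s))).
have a20 : 0 < 2 * a by rewrite mulr_gt0.
have := ih _ a20; have [a1|a1] := leP 1 a.
- rewrite (max_r (_ : 1 <= 2 * a)) ?powRM ?(ltW a0)//; last lra.
  rewrite -(lerD2l (a `^ (- s))) => /le_trans; apply.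
  by rewrite mulrA -[X in X + _]mul1r -mulrDl KE.
- rewrite add0r powR1 mulr1 => /le_trans; apply.
  by rewrite ler_piMr ?(ltW K0)// powRN_le1// le_max lexx.
Qed.

(** A geometric series read downwards from its last term below 1. The induction again passes from a
    to 2 * a, with the sharper bound K * (q - min(2, a)^s); it is 0 once a >= 2, and one step with a
    < 1 is the identity a^s + K * (q - (2 a)^s) = K * (q - a^s). *)
Lemma sum_dyadic_lt1_le a s N : 0 < a -> 0 < s ->
  \sum_(j < N | a * 2 ^+ j < 1) (a * 2 ^+ j) `^ s <= 2 `^ s / (2 `^ s - 1).
Proof.
move=> a0 s0; set q := 2 `^ s; have q1 : 1 < q by exact: powR2_gt1.
set K := (q - 1)^-1; have K0 : 0 < K by rewrite invr_gt0 subr_gt0.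
suff h : \sum_(j < N | a * 2 ^+ j < 1) (a * 2 ^+ j) `^ s <=
    K * (q - Num.min 2 a `^ s).
  by rewrite (le_trans h)// mulrC ler_pM2r// lerBlDr lerDl powR_ge0.
elim: N a a0 => [|N ih] a a0.
  rewrite big_ord0 mulr_ge0 ?(ltW K0)// subr_ge0 ler_powR2r ?(ltW s0)//.
    by rewrite le_min ler0n ltW.
  by rewrite ge_min lexx.
rewrite (sum_shift (fun t => t < 1) (fun t => t `^ s)).
have a20 : 0 < 2 * a by rewrite mulr_gt0.
have := ih _ a20; have [a1|a1] := ltP a 1.
- rewrite !min_r; [|lra|lra].
  rewrite powRM ?(ltW a0)// -/q => h.
  apply: le_trans (_ : a `^ s + K * (q - q * a `^ s) <= _).
    by rewrite lerD2l.
  rewrite le_eqVlt; apply/orP; left; apply/eqP; rewrite /K; field.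
  by rewrite subr_eq0 gt_eqF.
- rewrite add0r min_l; last lra.
  rewrite -/q subrr mulr0 => /le_trans; apply.
  rewrite mulr_ge0 ?(ltW K0)// subr_ge0 ler_powR2r ?(ltW s0)//.
    by rewrite le_min ler0n ltW.
  by rewrite ge_min lexx.
Qed.

(** This is the tail factor of [kernel_average_le_near] between the scales c0 and c0 * 2^j. One
    power of 2^j more than needed is absorbed by the exponential, which leaves the decay 1 / 2^j. *)
Lemma exprn_expR_dyadic_le n (b : R) : 0 < b ->
  exists2 C : R, 0 <= C &
    forall j, (2 ^+ j) ^+ n * expR (- ((2 ^+ j - 1) * b)) <= C / 2 ^+ j.
Proof.
move=> b0; exists ((n.+1%:R / b) ^+ n.+1 * expR b).
  by rewrite mulr_ge0 ?expR_ge0// exprn_ge0// divr_ge0// ltW.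
move=> j; set t : R := 2 ^+ j; have t0 : 0 < t by rewrite exprn_gt0.
rewrite ler_pdivlMr// mulrAC -exprSr.
have := powR_le_expR (ltr0Sn R n) (ltW t0) b0.
rewrite !powR_mulrn ?(ltW t0)// ?divr_ge0 ?(ltW b0)// => h.
rewrite (_ : - ((t - 1) * b) = - (b * t) + b); last by ring.
rewrite expRD mulrA ler_wpM2r ?expR_ge0//.
have := ler_wpM2r (expR_ge0 (- (b * t))) h.
by rewrite -[X in _ <= X -> _]mulrA -expRD subrr expR0 mulr1.
Qed.

End dyadic_sums.

Section norm1_topology.
Context {R : realType} {n : nat}.
Implicit Types x y : 'rV[R]_n.

Lemma continuous_rVP (f : 'rV[R]_n -> R) :
  continuous f <->
  forall x (e : R), 0 < e -> \forall y \near x, `|f x - f y| <= e.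
Proof.
split=> [cf x|cf x].
- by apply/(@cvgrPdist_le _ R^o _ _ (nbhs_filter x)); exact: cf.
- by apply/(@cvgrPdist_le _ R^o _ _ (nbhs_filter x)); exact: cf.
Qed.

Lemma near_norm1 x (d : R) : 0 < d -> \forall y \near x, norm1 (y - x) < d.
Proof.
(* Neighbourhoods come from the maximum norm. Dividing by n + 1 instead of n keeps the final
   inequality strict and covers dimension 0. *)
move=> d0; have e0 : 0 < d / n.+1%:R by rewrite divr_gt0.
apply/nbhs_ballP; exists (d / n.+1%:R) => //= y [_ xy].
apply: (@le_lt_trans _ _ (\sum_(i < n) d / n.+1%:R)).
  apply: ler_sum => i _; have := xy ord0 i; rewrite /ball/= distrC !mxE => /ltW.
  by [].
rewrite sumr_const card_ord -[X in X < _]mulr_natr -mulrA gtr_pMr//.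
by rewrite mulrC ltr_pdivrMr// mul1r ltr_nat.
Qed.

Lemma nbhs_norm1 x (U : set 'rV[R]_n) : nbhs x U ->
  exists2 r, 0 < r & forall y, norm1 (y - x) <= r -> U y.
Proof.
move=> /nbhs_ballP[e /= e0 eU]; exists (e / 2); first by rewrite divr_gt0.
move=> y yr; apply: eU; split=> // i j; rewrite /ball/= distrC.
have := coord_le_norm1 (y - x) j; rewrite !mxE (ord1 i); lra.
Qed.

End norm1_topology.

Section dyadic_maximal.
Context {R : realType} {n : nat}.
Implicit Types (x y h : 'rV[R]_n) (c : R).
Local Notation mu := (lebesgue_rV n).

(* The index 0 stands for f itself, which makes the supremum below lower
   bounded by f without a limit argument. *)
Definition dyadic_average c0 (f : 'rV[R]_n -> R) (j : nat) : 'rV[R]_n -> R :=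
  if j is i.+1 then kernel_average (c0 * 2 ^+ i) f else f.

(** [sups] is a supremum of reals, meaningful only for a sequence bounded above;
    [dyadic_average_ubound] provides this. *)
Definition dyadic_maximal c0 (f : 'rV[R]_n -> R) x : R :=
  sups (fun j => dyadic_average c0 f j x) 0.

Variables (p : R) (f : 'rV[R]_n -> R) (P : R).
Hypotheses (p1 : 1 < p) (mf : measurable_fun setT f).
Hypothesis fP : (\int[mu]_y (`|f y| `^ p)%:E = P%:E)%E.
Hypothesis cf : continuous f.

Lemma continuous_kernel_average c : 0 < c -> continuous (kernel_average c f).
Proof.
move=> c0; apply/continuous_rVP => x e e0.
have Q0 := kernel_oscillation_ge0 f x c0.
have Q1 : 0 < kernel_oscillation c f x + 1 by lra.
(* The solution of exp(c * d) - 1 = e / (Q + 1), where Q is the oscillation at x; the 1 added to Q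
   prevents a division by 0. *)
pose d := ln (1 + e / (kernel_oscillation c f x + 1)) / c.
have eQ0 : 0 < e / (kernel_oscillation c f x + 1) by rewrite divr_gt0.
have d0 : 0 < d by rewrite divr_gt0// ln_gt0//; lra.
near=> y; have yd : norm1 (y - x) < d by near: y; exact: near_norm1.
have xy : x + (y - x) = y by rewrite addrC subrK.
have := normr_kernel_average_shiftB_le p1 mf fP x (y - x) c0.
rewrite xy.
rewrite [X in X <= _ -> _]distrC => /le_trans; apply.
have : expR (c * norm1 (y - x)) <= 1 + e / (kernel_oscillation c f x + 1).
  rewrite -[leRHS]lnK ?posrE ?ler_expR; last lra.
  by rewrite mulrC -ler_pdivlMr// ltW.
rewrite -lerBlDl => h.
apply: le_trans (ler_wpM2r Q0 h) _.
by rewrite mulrAC ler_pdivrMr// ler_wpM2l ?(ltW e0)//; lra.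
Unshelve. all: by end_near. Qed.

Hypothesis f0 : forall x, 0 <= f x.
Variable c0 : R.
Hypothesis c0_gt0 : 0 < c0.

Let cj0 j : 0 < c0 * 2 ^+ j. Proof. by rewrite mulr_gt0// exprn_gt0. Qed.

Lemma dyadic_average_ge0 j x : 0 <= dyadic_average c0 f j x.
Proof. by case: j => [|j] /=; [exact: f0|exact: kernel_average_ge0]. Qed.

(** Near x the values of f are at most f x + e / 2, and the mass of the kernel away from y
    contributes a tail that vanishes as j grows. The bound is uniform in y near x and in all j >= J,
    so only finitely many averages remain to be controlled one by one. *)
Lemma kernel_average_usc x (e : R) : 0 < e -> exists J r,
  0 < r /\ forall y, norm1 (y - x) <= r -> forall j, (J <= j)%N ->
    kernel_average (c0 * 2 ^+ j) f y <= f x + e.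
Proof.
move=> e0; have e20 : 0 < e / 2 by rewrite divr_gt0.
have /nbhs_norm1[r r0 fr] : \forall y \near x, f y <= f x + e / 2.
  have := (continuous_rVP f).1 cf x _ e20.
  by apply: filterS => y; rewrite ler_norml => /andP[]; lra.
have r20 : 0 < r / 2 by rewrite divr_gt0.
have [C C0 hC] := exprn_expR_dyadic_le n (mulr_gt0 c0_gt0 r20).
(* Bounds the average at the coarsest scale, which multiplies the tail factor, for every y within r
   / 2 of x. *)
pose H := expR (c0 * (r / 2)) * kernel_average c0 f x.
have H0 : 0 <= H by rewrite mulr_ge0 ?expR_ge0// kernel_average_ge0.
have CH0 : 0 <= C * H / (e / 2) by apply: divr_ge0; [exact: mulr_ge0|exact: ltW].
(* The tail is at most C * H / 2^j, and 2^j > j >= J makes this at most e / 2. Halving r keeps the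
   ball of radius r / 2 around y inside the ball of radius r around x. *)
exists (Num.bound (C * H / (e / 2))), (r / 2); split=> // y yx j Jj.
have fy z : norm1 (z - y) <= r / 2 -> f z <= f x + e / 2.
  move=> zy; apply: fr; have := norm1D (z - y) (y - x).
  by rewrite addrA subrK; lra.
have cc : c0 <= c0 * 2 ^+ j by rewrite ler_peMr ?(ltW c0_gt0)// exprn_ege1// ler1n.
have fe0 : 0 <= f x + e / 2 by rewrite addr_ge0 ?f0// ltW.
have := kernel_average_le_near p1 mf fP f0 c0_gt0 cc fe0 fy.
have -> : c0 * 2 ^+ j / c0 = 2 ^+ j by rewrite mulrAC divff ?mul1r ?gt_eqF.
have -> : (c0 * 2 ^+ j - c0) * (r / 2) = (2 ^+ j - 1) * (c0 * (r / 2)) by ring.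
move=> /le_trans; apply.
have -> : f x + e = f x + e / 2 + e / 2 by lra.
rewrite lerD2l.
have Ay : kernel_average c0 f y <= H.
  have xy : x + (y - x) = y by rewrite addrC subrK.
  have := kernel_average_shift_le p1 mf fP f0 x (y - x) c0_gt0.
  rewrite xy => /le_trans; apply; rewrite ler_wpM2r ?kernel_average_ge0//.
  by rewrite ler_expR ler_pM2l.
apply: (@le_trans _ _ (C / 2 ^+ j * H)).
  by apply: ler_pM => //; exact: kernel_average_ge0.
rewrite mulrAC ler_pdivrMr ?exprn_gt0// -ler_pdivrMl// mulrC.
apply: le_trans (ltW (archi_boundP CH0)) _.
rewrite -natrX ler_nat (leq_trans Jj)// ltnW// ltn_expl//.
Qed.

(** The tail of the sequence is controlled by [kernel_average_usc] with e = 1, and the finitely many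
    other averages by their sum. *)
Lemma dyadic_average_ubound x :
  has_ubound (range (fun j => dyadic_average c0 f j x)).
Proof.
have [J [r [r0 h]]] := kernel_average_usc x ltr01.
exists (f x + 1 + \sum_(j < J) kernel_average (c0 * 2 ^+ j) f x) => _ [[|j] _ <-] /=.
  rewrite -addrA lerDl addr_ge0// sumr_ge0// => j _.
  exact: kernel_average_ge0.
have [Jj|jJ] := leqP J j.
  apply: (@le_trans _ _ (f x + 1)).
    apply: h => //; rewrite subrr /norm1 big1 ?(ltW r0)// => i _.
    by rewrite mxE normr0.
  by rewrite lerDl sumr_ge0// => i _; exact: kernel_average_ge0.
rewrite (bigD1 (Ordinal jJ))//= addrCA lerDl addr_ge0//.
  by rewrite addr_ge0.
by apply: sumr_ge0 => i _; exact: kernel_average_ge0.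
Qed.

Lemma dyadic_average_le_maximal j x :
  dyadic_average c0 f j x <= dyadic_maximal c0 f x.
Proof.
apply: ub_le_sup; last by exists j.
by apply: subset_has_ubound (dyadic_average_ubound x) => _ [i _ <-]; exists i.
Qed.

Lemma dyadic_maximal_le x (M : R) :
  (forall j, dyadic_average c0 f j x <= M) -> dyadic_maximal c0 f x <= M.
Proof.
move=> h; apply: ge_sup; first by exists (f x), 0%N.
by move=> _ [j _ <-].
Qed.

Lemma measurable_dyadic_maximal : measurable_fun setT (dyadic_maximal c0 f).
Proof.
apply: measurable_fun_sups => [x _|[|j]] //=; first exact: dyadic_average_ubound.
exact: measurable_kernel_average.
Qed.

Lemma dyadic_maximal_ge0 x : 0 <= dyadic_maximal c0 f x.
Proof. exact: le_trans (f0 x) (dyadic_average_le_maximal 0 x). Qed.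

Lemma normr_dyadic_maximalB_le x y (M : R) :
  (forall j, `|dyadic_average c0 f j x - dyadic_average c0 f j y| <= M) ->
  `|dyadic_maximal c0 f x - dyadic_maximal c0 f y| <= M.
Proof.
move=> h; rewrite ler_norml; apply/andP; split.
- rewrite lerBrDl lerBlDr; apply: dyadic_maximal_le => j.
  have := h j; have := dyadic_average_le_maximal j x.
  by rewrite ler_norml => ? /andP[]; lra.
- rewrite lerBlDl; apply: dyadic_maximal_le => j.
  have := h j; have := dyadic_average_le_maximal j y.
  by rewrite ler_norml => ? /andP[]; lra.
Qed.

Lemma continuous_dyadic_average j : continuous (dyadic_average c0 f j).
Proof. by case: j => [|j] //; exact: continuous_kernel_average. Qed.

(** From below, a single index that nearly attains the supremum at x suffices. From above, the small
    indices are finitely many continuous functions, and the others are at most f x + e, hence at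
    most the supremum at x plus e. *)
Lemma continuous_dyadic_maximal : continuous (dyadic_maximal c0 f).
Proof.
apply/continuous_rVP => x e e0.
have [J [r [r0 hJ]]] := kernel_average_usc x e0.
have [_ [j _ <-] jx] : exists2 z,
    [set dyadic_average c0 f k x | k in [set k | (0 <= k)%N]] z &
    dyadic_maximal c0 f x - e / 2 < z.
  apply: sup_adherent; first by rewrite divr_gt0.
  split; first by exists (f x), 0%N.
  by apply: subset_has_ubound (dyadic_average_ubound x) => _ [i _ <-]; exists i.
have e20 : 0 < e / 2 by rewrite divr_gt0.
have nearF i : \forall y \near x,
    `|dyadic_average c0 f i x - dyadic_average c0 f i y| <= e / 2.
  by have /continuous_rVP := @continuous_dyadic_average i; apply.
near=> y.
have yr : norm1 (y - x) <= r by apply: ltW; near: y; exact: near_norm1.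
have fin : forall i : 'I_J.+1,
    `|dyadic_average c0 f i x - dyadic_average c0 f i y| <= e / 2.
  near: y; apply: filter_forall => i.
  exact: nearF.
have yj : `|dyadic_average c0 f j x - dyadic_average c0 f j y| <= e / 2.
  near: y; exact: nearF.
rewrite ler_norml; apply/andP; split.
- rewrite lerBrDl lerBlDr; apply: dyadic_maximal_le => i.
  (* The threshold is J + 1 because index i + 1 carries scale number i, index 0 being f itself. *)
  have [iJ|Ji] := ltnP i J.+1.
    have := fin (Ordinal iJ); have := dyadic_average_le_maximal i x.
    by rewrite ler_norml /= => ? /andP[]; lra.
  case: i Ji => [//|i] Ji /=.
  have := hJ _ yr i Ji; have := dyadic_average_le_maximal 0 x; rewrite /=; lra.
- have := dyadic_average_le_maximal j y.
  move: yj; rewrite ler_norml => /andP[]; lra.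
Unshelve. all: by end_near. Qed.

End dyadic_maximal.

Section integral_series.
Context d (T : measurableType d) (R : realType) (mu : {measure set T -> \bar R}).
Local Open Scope ereal_scope.

(** Monotone convergence, packaged so that a supremum dominated by one term plus a series of
    oscillations needs only a uniform bound on partial sums. *)
Lemma integral_le_addseries (D u : T -> R) (t : nat -> T -> R) (U M : R)
    (b : nat -> R) :
  measurable_fun setT D -> measurable_fun setT u ->
  (forall j, measurable_fun setT (t j)) ->
  (forall x, 0 <= D x)%R -> (forall x, 0 <= u x)%R ->
  (forall j x, 0 <= t j x)%R ->
  (forall x, (D x)%:E <= (u x)%:E + \sum_(j <oo) (t j x)%:E) ->
  \int[mu]_x (u x)%:E <= U%:E ->
  (forall j, \int[mu]_x (t j x)%:E <= (b j)%:E) ->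
  (forall N, \sum_(j < N) b j <= M)%R ->
  \int[mu]_x (D x)%:E <= (U + M)%:E.
Proof.
move=> mD mu' mt D0 u0 t0 Dut uU tb bM.
have mseries : measurable_fun setT (fun x => \sum_(j <oo) (t j x)%:E).
  apply: ge0_emeasurable_sum => [j x _ _|j _]; first by rewrite lee_fin.
  exact/measurable_EFinP.
apply: (@le_trans _ _ (\int[mu]_x ((u x)%:E + \sum_(j <oo) (t j x)%:E))).
  apply: ge0_le_integral => //; [by move=> x _; rewrite lee_fin|
    exact/measurable_EFinP|by apply: emeasurable_funD => //; exact/measurable_EFinP].
rewrite ge0_integralD//; [|by move=> x _; rewrite lee_fin|exact/measurable_EFinP|
  by move=> x _; apply: nneseries_ge0 => j _ _; rewrite lee_fin].
rewrite EFinD; apply: leeD => //.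
rewrite integral_nneseries//; [|by move=> j; exact/measurable_EFinP|
  by move=> j x _; rewrite lee_fin].
have int0 j : 0 <= \int[mu]_x (t j x)%:E.
  by apply: integral_ge0 => x _; rewrite lee_fin.
apply: lime_le; first by apply: is_cvg_nneseries => j _ _; exact: int0.
apply: nearW => N; apply: (@le_trans _ _ (\sum_(0 <= j < N) (b j)%:E)).
  by apply: lee_sum => j _; exact: tb.
by rewrite big_mkord sumEFin lee_fin.
Qed.

End integral_series.

(** * Norm and difference bounds for the maximal function *)

Section dyadic_maximal_besov.
Context {R : realType} {n : nat}.
Implicit Types (x y h u : 'rV[R]_n) (c : R).
Local Notation mu := (lebesgue_rV n).
Variables (p s : R) (f : 'rV[R]_n -> R) (P B : R).
Hypotheses (p1 : 1 < p) (s0 : 0 < s) (sp : s < p).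
Hypothesis mf : measurable_fun setT f.
Hypothesis fP : (\int[mu]_y (`|f y| `^ p)%:E = P%:E)%E.
Hypothesis cf : continuous f.
Hypothesis f0 : forall x, 0 <= f x.
Hypothesis B0 : 0 <= B.
Hypothesis fB : forall u,
  (\int[mu]_x (`|f (x + u) - f x| `^ p)%:E <= (norm1 u `^ s * B)%:E)%E.
Variable c0 : R.
Hypothesis c0_gt0 : 0 < c0.

Let cj j := c0 * 2 ^+ j.
Let cj0 j : 0 < cj j. Proof. by rewrite mulr_gt0// exprn_gt0. Qed.
Let Q j x := kernel_oscillation (cj j) f x.
Let Q0 j x : 0 <= Q j x. Proof. exact: kernel_oscillation_ge0. Qed.
Let mQ j : measurable_fun setT (fun x => Q j x `^ p).
Proof. by apply: measurable_powRr_comp; exact: measurable_kernel_oscillation. Qed.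
Let K1 : R := (2 * s) `^ s * 2 ^+ n.
Let K10 : 0 <= K1. Proof. by rewrite mulr_ge0 ?powR_ge0. Qed.
Let p0 : 0 <= p. Proof. by rewrite ltW// (lt_trans ltr01). Qed.

Let p2 : 1 <= 2 `^ p :> R.
Proof.
have : 1 `^ p <= 2 `^ p :> R by apply: ler_powR2r => //; rewrite ler1n.
by rewrite powR1.
Qed.

Let intQ j : (\int[mu]_x (Q j x `^ p)%:E <= (K1 * cj j `^ (- s) * B)%:E)%E.
Proof. exact: (integral_kernel_oscillation_powR p1 mf fP (cj0 j) s0 B0 fB). Qed.

(** Bounds the p-th power of a least upper bound by taking the p-th root of S. S is extended because
    it will be a series that may diverge at some points. *)
Let powR_sup_le (a : nat -> R) (D : R) (S : \bar R) :
  (forall j, 0 <= a j) -> 0 <= D ->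
  (forall M, (forall j, a j <= M) -> D <= M) ->
  (forall j, (a j `^ p)%:E <= S)%E -> ((D `^ p)%:E <= S)%E.
Proof.
move=> a0 D0 aD; case: S => [r| |] h.
- have r0 : 0 <= r.
    by have := h 0%N; rewrite lee_fin; apply: le_trans; exact: powR_ge0.
  have pN0 : p != 0 by rewrite gt_eqF// (lt_trans ltr01).
  have /aD Dr : forall j, a j <= r `^ p^-1.
    move=> j; have := h j; rewrite lee_fin => /(ler_powR2r _ (powR_ge0 _ _)).
    by move=> /(_ p^-1); rewrite invr_ge0 -powRrM mulfV// powRr1//; apply.
  rewrite lee_fin; have := ler_powR2r p0 D0 Dr.
  by rewrite -powRrM mulVf// powRr1.
- exact: leey.
- by have := h 0%N; rewrite leeNy_eq.
Qed.

(** Each average is at most f + Q_j, and the integrals of Q_j^p are summable because the scales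
    increase geometrically from c0. The bound blows up as c0 tends to 0, but only finiteness is
    claimed. *)
Lemma integral_dyadic_maximal_powR_lty :
  (\int[mu]_x (`|dyadic_maximal c0 f x| `^ p)%:E < +oo)%E.
Proof.
have g0 := dyadic_maximal_ge0 p1 mf fP cf f0 c0_gt0.
have mg : measurable_fun setT (dyadic_maximal c0 f).
  exact: measurable_dyadic_maximal p1 mf fP cf f0 _ c0_gt0.
pose M := 2 `^ p * (K1 * c0 `^ (- s) * B * (1 - 2 `^ (- s))^-1).
apply: (@le_lt_trans _ _ (2 `^ p * P + M)%:E); last exact: ltry.
have mfp : measurable_fun setT (fun x => `|f x| `^ p).
  by apply: measurable_powRr_comp; exact: measurableT_comp.
apply: (integral_le_addseries (u := fun x => 2 `^ p * `|f x| `^ p)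
  (t := fun j x => 2 `^ p * Q j x `^ p)
  (b := fun j => 2 `^ p * (K1 * cj j `^ (- s) * B))).
- by apply: measurable_powRr_comp; exact: measurableT_comp.
- by apply: measurable_funM.
- by move=> j; apply: measurable_funM.
- by move=> x; exact: powR_ge0.
- by move=> x; rewrite mulr_ge0 ?powR_ge0.
- by move=> j x; rewrite mulr_ge0 ?powR_ge0.
- move=> x; rewrite ger0_norm//.
  apply: (powR_sup_le (a := fun j => dyadic_average c0 f j x)) => //.
  + by move=> j; exact: dyadic_average_ge0.
  + by move=> r; exact: dyadic_maximal_le.
  + have t0 j : (0 <= (2 `^ p * Q j x `^ p)%:E)%E.
      by rewrite lee_fin mulr_ge0 ?powR_ge0.
    case=> [|j] /=.
      rewrite (le_trans (_ : _ <= (2 `^ p * `|f x| `^ p)%:E)%E)//.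
        by rewrite lee_fin ger0_norm// ler_peMl ?powR_ge0.
      by rewrite leeDl// nneseries_ge0.
    apply: (@le_trans _ _ ((2 `^ p * `|f x| `^ p)%:E + (2 `^ p * Q j x `^ p)%:E)%E).
      rewrite -EFinD lee_fin -mulrDr.
      apply: le_trans (powRD_le (normr_ge0 (f x)) (Q0 j x) p0).
      apply: ler_powR2r => //; first exact: (kernel_average_ge0 f0 x (cj0 j)).
      have := normr_kernel_averageB_le p1 mf fP x (cj0 j).
      by rewrite (ger0_norm (f0 x)) ler_norml -/(Q j x) => /andP[_]; rewrite lerBlDl.
    rewrite leeD2l//.
    apply: le_trans (nneseries_lim_ge j.+1 (fun i _ _ => t0 i)).
    rewrite big_nat_recr//= leeDr//.
    by apply: sume_ge0 => i _; exact: t0.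
- by rewrite ge0_integralZl_real ?fP ?powR_ge0// => x; exact: powR_ge0.
- move=> j; rewrite ge0_integralZl_real ?powR_ge0//;
    last by move=> x; exact: powR_ge0.
  by rewrite EFinM lee_wpmul2l ?lee_fin ?powR_ge0.
- move=> N; rewrite -mulr_sumr ler_wpM2l ?powR_ge0//.
  rewrite -mulr_suml -mulr_sumr.
  set X := (1 - _)^-1.
  have -> : K1 * c0 `^ (- s) * B * X = K1 * (c0 `^ (- s) * X) * B by ring.
  rewrite ler_wpM2r// ler_wpM2l//.
  under eq_bigr do rewrite powRM ?(ltW c0_gt0)//.
  rewrite -mulr_sumr ler_wpM2l ?powR_ge0//.
  (* Once c0^(- s) is factored out the scales are 2^j >= 1, so the filter of the lemma at a = 1
     keeps every index. *)
  apply: le_trans (sum_dyadic_ge1_le N ltr01 s0).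
  rewrite [leRHS]big_mkcond; apply: ler_sum => j _.
  by rewrite mul1r exprn_ege1// ler1n.
Qed.

(** Multiplying exp(- z) >= 1 - z by exp z gives exp z - 1 <= z * exp z. *)
Let expR_sub1_le (z : R) : 0 <= z -> z < 1 -> expR z - 1 <= expR 1 * z.
Proof.
move=> z0 z1; have := expR_ge1Dx (- z).
rewrite -(ler_pM2r (expR_gt0 z)) -expRD addNr expR0 mulrDl mul1r mulNr => h.
apply: (@le_trans _ _ (z * expR z)); first lra.
by rewrite mulrC ler_wpM2r// ler_expR ltW.
Qed.

(** Free of c0. The outer 2^p * 2^p comes from splitting the p-th power of |f(x + h) - f x| + Q_j(x
    + h) + Q_j(x) into three powers. The bracket holds the geometric sums over fine scales, doubled
    for the two oscillations, and over coarse scales, where expR 1 comes from the bound on exp z -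
    1. *)
Definition dyadic_maximal_const : R :=
  2 `^ p * 2 `^ p + (2 * s) `^ s * 2 ^+ n *
  (2 * (2 `^ p * 2 `^ p) * (1 - 2 `^ (- s))^-1 +
   expR 1 `^ p * (2 `^ (p - s) / (2 `^ (p - s) - 1))).

(* With L = |h|_1: at the scales with 1 <= c L the averages are compared with f
   itself, at the coarser ones the kernel is compared with its translate. *)
Lemma integral_dyadic_maximal_difference_powR h : h != 0 ->
  (\int[mu]_x (`|dyadic_maximal c0 f (x + h) - dyadic_maximal c0 f x| `^ p)%:E
   <= (dyadic_maximal_const * (norm1 h `^ s * B))%:E)%E.
Proof.
move=> h_neq0; set L := norm1 h.
have L0 : 0 < L.
  rewrite lt_neqAle norm1_ge0 andbT eq_sym.
  by apply: contra_neq h_neq0; exact: norm1_eq0.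
pose w j := c0 * L * 2 ^+ j.
have wE j : cj j * L = w j by rewrite /cj /w mulrAC.
have w0 j : 0 < w j by rewrite /w !mulr_gt0// exprn_gt0.
(* Extracts the required factor L^s; what is left depends on c_j and h only through the
   dimensionless w j. *)
have cjs j : cj j `^ (- s) = L `^ s * w j `^ (- s).
  rewrite -wE powRM ?(ltW (cj0 j)) ?(ltW L0)// mulrCA -powRD ?addrN ?powRr0 ?mulr1//.
  by rewrite eqxx (gt_eqF L0).
pose K : R := 2 `^ p * 2 `^ p; have K0 : 0 <= K by rewrite mulr_ge0 ?powR_ge0.
have mshift (g : 'rV[R]_n -> R) : measurable_fun setT g ->
    measurable_fun setT (fun x => g (x + h)).
  by move=> mg; apply: measurableT_comp => //; exact: measurable_rVD.
have mg : measurable_fun setT (dyadic_maximal c0 f).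
  exact: measurable_dyadic_maximal p1 mf fP cf f0 _ c0_gt0.
have mfh : measurable_fun setT (fun x => `|f (x + h) - f x| `^ p).
  apply: measurable_powRr_comp; apply: measurableT_comp => //.
  by apply: measurable_funB => //; exact: mshift.
have ps0 : 0 < p - s by rewrite subr_gt0.
(* Fine scales contribute w^(- s), summable since s > 0; coarse ones gain w^p from the kernel
   difference, and w^(p - s) is summable since s < p. *)
pose e j : R := if 1 <= w j then 2 * K * w j `^ (- s)
                else expR 1 `^ p * w j `^ (p - s).
have intQh j :
    (\int[mu]_x (Q j (x + h) `^ p)%:E <= (K1 * cj j `^ (- s) * B)%:E)%E.
  apply: le_trans (intQ j); rewrite le_eqVlt; apply/orP; left; apply/eqP.
  apply: (ge0_integral_rV_shift h (F := fun x => (Q j x `^ p)%:E)).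
    exact/measurable_EFinP.
  by move=> x; rewrite lee_fin powR_ge0.
rewrite /dyadic_maximal_const -/K -/K1 mulrDl.
apply: (integral_le_addseries (u := fun x => K * `|f (x + h) - f x| `^ p)
  (t := fun j x => if 1 <= w j then K * (Q j (x + h) `^ p + Q j x `^ p)
                   else (expR 1 * w j) `^ p * Q j x `^ p)
  (b := fun j => L `^ s * B * K1 * e j)).
- apply: measurable_powRr_comp; apply: measurableT_comp => //.
  by apply: measurable_funB => //; exact: mshift.
- by apply: measurable_funM.
- move=> j; case: (1 <= w j); apply: measurable_funM => //.
  by apply: measurable_funD => //; exact: (mshift _ (mQ j)).
- by move=> x; exact: powR_ge0.
- by move=> x; rewrite mulr_ge0 ?powR_ge0.
- by move=> j x; case: ifPn => _; rewrite mulr_ge0 ?addr_ge0 ?powR_ge0.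
- move=> x.
  apply: (powR_sup_le
    (a := fun j => `|dyadic_average c0 f j (x + h) - dyadic_average c0 f j x|)) => //.
  + move=> M; exact: normr_dyadic_maximalB_le p1 mf fP cf f0 _ c0_gt0 _ _ _.
  + pose t j : \bar R := (if 1 <= w j then K * (Q j (x + h) `^ p + Q j x `^ p)
                            else (expR 1 * w j) `^ p * Q j x `^ p)%:E.
    have t0 j : (0 <= t j)%E.
      rewrite /t lee_fin.
      by case: (1 <= w j); rewrite mulr_ge0 ?addr_ge0 ?powR_ge0.
    case=> [|j] /=.
      rewrite (le_trans (_ : _ <= (K * `|f (x + h) - f x| `^ p)%:E)%E)//.
        rewrite lee_fin ler_peMl ?powR_ge0//.
        by rewrite -[1]mulr1 ler_pM.
      by rewrite leeDl//; apply: nneseries_ge0 => i _ _; exact: t0.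
    apply: (@le_trans _ _ ((K * `|f (x + h) - f x| `^ p)%:E + t j)%E); last first.
      rewrite leeD2l//; apply: le_trans (nneseries_lim_ge j.+1 (fun i _ _ => t0 i)).
      by rewrite big_nat_recr//= leeDr//; apply: sume_ge0 => i _; exact: t0.
    rewrite /t -EFinD lee_fin -/(cj j).
    have dx : 0 <= `|f (x + h) - f x| `^ p by exact: powR_ge0.
    case: ifPn => [w1|]; last rewrite -ltNge => w1.
    * apply: (@le_trans _ _ ((`|f (x + h) - f x| + (Q j (x + h) + Q j x)) `^ p)).
        apply: ler_powR2r => //.
        have := normr_kernel_averageB_le p1 mf fP (x + h) (cj0 j).
        have := normr_kernel_averageB_le p1 mf fP x (cj0 j).
        rewrite -/(Q j x) -/(Q j (x + h)) !ler_norml.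
        move: (kernel_average _ _ _) (kernel_average _ _ _) => a b.
        have := ler_norm (f (x + h) - f x); have := ler_norm (- (f (x + h) - f x)).
        by rewrite normrN => ? ? /andP[? ?] /andP[? ?]; apply/andP; split; lra.
      apply: le_trans (powRD_le _ _ p0) _ => //; first exact: addr_ge0.
      rewrite /K -mulrDr -mulrA ler_wpM2l ?powR_ge0// mulrDr lerD//.
        by rewrite ler_peMl.
      exact: powRD_le.
    * apply: (@le_trans _ _ ((expR 1 * w j) `^ p * Q j x `^ p)); last first.
        by rewrite lerDr mulr_ge0.
      have Ew : 0 <= expR 1 * w j by rewrite mulr_ge0 ?expR_ge0// ltW.
      rewrite -(powRM p Ew (Q0 j x)); apply: ler_powR2r => //.
      apply: le_trans (normr_kernel_average_shiftB_le p1 mf fP x h (cj0 j)) _.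
      have := expR_sub1_le (ltW (w0 j)) w1; rewrite -{1}wE.
      exact: (ler_wpM2r (Q0 j x)).
- rewrite ge0_integralZl_real//.
  by rewrite [leRHS]EFinM lee_wpmul2l ?lee_fin// fB.
- move=> j; rewrite /e; case: (1 <= w j).
  + rewrite ge0_integralZl_real//;
      [|by apply: measurable_funD => //; exact: (mshift _ (mQ j))|
        by move=> x; rewrite addr_ge0 ?powR_ge0].
    under eq_integral do rewrite EFinD.
    rewrite ge0_integralD//; [|by move=> x _; rewrite lee_fin powR_ge0|
      by apply/measurable_EFinP; exact: (mshift _ (mQ j))|
      by move=> x _; rewrite lee_fin powR_ge0|exact/measurable_EFinP].
    have KE0 : (0 <= K%:E)%E by rewrite lee_fin.
    have := lee_wpmul2l KE0 (leeD (intQh j) (intQ j)).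
    move=> /le_trans; apply.
    rewrite -EFinD -EFinM lee_fin cjs le_eqVlt; apply/orP; left; apply/eqP; ring.
  + rewrite ge0_integralZl_real ?powR_ge0//; last by move=> x; exact: powR_ge0.
    apply: le_trans (lee_wpmul2l _ (intQ j)) _; first by rewrite lee_fin powR_ge0.
    rewrite -EFinM lee_fin cjs powRM ?expR_ge0 ?(ltW (w0 j))//.
    rewrite powRD ?(gt_eqF (w0 j)) ?implybT//.
    by rewrite le_eqVlt; apply/orP; left; apply/eqP; ring.
- move=> N; rewrite -mulr_sumr.
  rewrite [leRHS]mulrC [leRHS]mulrA.
  rewrite ler_wpM2l ?mulr_ge0 ?powR_ge0//.
  rewrite (bigID (fun j : 'I_N => 1 <= w j)) /=; apply: lerD.
  + apply: (@le_trans _ _ (\sum_(j < N | 1 <= w j) 2 * K * w j `^ (- s))).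
      rewrite le_eqVlt; apply/orP; left; apply/eqP.
      by apply: eq_bigr => j w1; rewrite /e w1.
    rewrite -mulr_sumr ler_wpM2l ?mulr_ge0//.
    by apply: sum_dyadic_ge1_le => //; rewrite mulr_gt0.
  + apply: (@le_trans _ _ (\sum_(j < N | w j < 1) expR 1 `^ p * w j `^ (p - s))).
      rewrite le_eqVlt; apply/orP; left; apply/eqP.
      apply: eq_big => j; first by rewrite ltNge.
      by rewrite /e => /negbTE ->.
    rewrite -mulr_sumr ler_wpM2l ?powR_ge0//.
    by apply: sum_dyadic_lt1_le => //; rewrite mulr_gt0.
Qed.

End dyadic_maximal_besov.

(** * Besov seminorm and capacity *)

Section besov.
Context {R : realType} {n : nat}.
Implicit Types (f g : 'rV[R]_n -> R) (x y h u : 'rV[R]_n).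
Local Notation mu := (lebesgue_rV n).

Lemma euclidean_norm_eq0 u : euclidean_norm u = 0 -> u = 0.
Proof.
move=> u0; apply: norm1_eq0; apply/eqP; rewrite eq_le norm1_ge0 andbT.
by have := norm1_le_euclidean_norm u; rewrite u0 mulr0.
Qed.

Lemma euclidean_norm_gt0 u : u != 0 -> 0 < euclidean_norm u.
Proof.
move=> u0; rewrite lt_neqAle euclidean_norm_ge0 andbT eq_sym.
by apply: contra_neq u0; exact: euclidean_norm_eq0.
Qed.

Lemma euclidean_norm_distC x y : euclidean_norm (x - y) = euclidean_norm (y - x).
Proof.
by congr Num.sqrt; apply: eq_bigr => i _; rewrite !mxE -sqrrN opprB.
Qed.

Variables (alpha p : R).
Hypotheses (p1 : 1 < p).
Let p0 : 0 < p. Proof. exact: lt_trans p1. Qed.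

Lemma LfunP_powR f : (f \in Lfun mu p%:E) <->
  measurable_fun setT f /\ (\int[mu]_x (`|f x| `^ p)%:E < +oo)%E.
Proof.
have E : ('N[mu]_p%:E[EFin \o f] `^ p = \int[mu]_x (`|f x| `^ p)%:E)%E.
  by rewrite poweR_Lnorm ?gt_eqF.
split.
- rewrite inE => /andP[]; rewrite !inE /= => mf fN; split=> //.
  by rewrite -E poweR_lty.
- move=> [mf fN]; rewrite inE; apply/andP; split; rewrite inE//=.
  by rewrite /finite_norm; apply: (lty_poweRy (r := p)); rewrite ?gt_eqF// E.
Qed.

Lemma besov_seminorm_le g (M : R) : 0 <= M ->
  (forall h, h != 0 -> (\int[mu]_x (`|g (x + h) - g x| `^ p)%:E <=
    ((euclidean_norm h `^ alpha * M) `^ p)%:E)%E) ->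
  (besov_seminorm alpha p g <= M%:E)%E.
Proof.
move=> M0 gM; apply: ge_ereal_sup => _ [h /= h0 <-].
have e0 := euclidean_norm_gt0 h0.
have -> : M = euclidean_norm h `^ (- alpha) * (euclidean_norm h `^ alpha * M).
  by rewrite mulrA -powRD ?addNr ?powRr0 ?mul1r// eqxx (gt_eqF e0).
rewrite EFinM lee_wpmul2l ?lee_fin ?powR_ge0//.
have gM' : (('N[mu]_p%:E[EFin \o difference h g]) `^ p <=
    ((euclidean_norm h `^ alpha * M) `^ p)%:E)%E.
  by rewrite poweR_Lnorm ?gt_eqF//; exact: gM.
have pV0 : 0 <= p^-1 by rewrite invr_ge0 ltW.
have := gt0_ler_poweR pV0 _ _ gM'; rewrite !in_itv/= !leey !poweR_ge0.
rewrite -poweRrM mulfV ?gt_eqF// poweRe1 ?Lnorm_ge0//.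
rewrite -powRrM mulfV ?gt_eqF// powRr1 ?mulr_ge0 ?powR_ge0//; apply=> //.
by rewrite lee_fin powR_ge0.
Qed.

(** The supremum omits h = 0, but there the integral is 0, so the estimate can be integrated over
    all h later. *)
Lemma le_besov_seminorm f (s : R) : 0 <= s ->
  (besov_seminorm alpha p f <= s%:E)%E -> forall h,
  (\int[mu]_x (`|f (x + h) - f x| `^ p)%:E <=
    ((euclidean_norm h `^ alpha * s) `^ p)%:E)%E.
Proof.
move=> s0 fs h; have [->|h0] := eqVneq h 0.
  under eq_integral do rewrite addr0 subrr normr0 powR0 ?gt_eqF//.
  by rewrite integral0 lee_fin powR_ge0.
have e0 := euclidean_norm_gt0 h0.
have hs : ((euclidean_norm h `^ (- alpha))%:E *
    'N[mu]_p%:E[EFin \o difference h f] <= s%:E)%E.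
  by apply: le_trans fs; apply: ereal_sup_ubound; exists h.
have {}hs : ('N[mu]_p%:E[EFin \o difference h f] <=
    (euclidean_norm h `^ alpha * s)%:E)%E.
  rewrite EFinM muleC -lee_pdivrMr ?powR_gt0// muleC.
  by rewrite powRN in hs.
have -> : (\int[mu]_x (`|f (x + h) - f x| `^ p)%:E =
    'N[mu]_p%:E[EFin \o difference h f] `^ p)%E.
  by rewrite poweR_Lnorm ?gt_eqF.
rewrite -poweR_EFin gt0_ler_poweR ?(ltW p0)// in_itv/= leey andbT.
- exact: Lnorm_ge0.
- by rewrite lee_fin mulr_ge0 ?powR_ge0.
Qed.

(** In dimension 0 no h is nonzero and the supremum is -oo; for n > 0 the all-ones vector is a
    witness. *)
Lemma besov_seminorm_ge0 f : (0 < n)%N -> (0 <= besov_seminorm alpha p f)%E.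
Proof.
move=> n0; pose h : 'rV[R]_n := const_mx 1.
have h0 : h != 0.
  apply/negP => /eqP/rowP /(_ (Ordinal n0)); rewrite !mxE => /eqP.
  by rewrite oner_eq0.
apply: le_trans (_ : (_ <= (euclidean_norm h `^ (- alpha))%:E *
    'N[mu]_p%:E[EFin \o difference h f])%E) _.
  by rewrite mule_ge0 ?Lnorm_ge0// lee_fin powR_ge0.
by apply: ereal_sup_ubound; exists h.
Qed.

Lemma besov_space_seminormE f : (0 < n)%N -> besov_space alpha p f ->
  exists2 s : R, 0 <= s & besov_seminorm alpha p f = s%:E.
Proof.
move=> n0 [_ fy]; exists (fine (besov_seminorm alpha p f)).
  by rewrite fine_ge0// besov_seminorm_ge0.
by rewrite fineK// ge0_fin_numE// besov_seminorm_ge0.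
Qed.

Lemma besov_scale f (k : R) : (0 < n)%N -> 0 <= k -> besov_space alpha p f ->
  besov_space alpha p (fun x => k * f x) /\
  (besov_seminorm alpha p (fun x => (k * f x)%R) <=
   k%:E * besov_seminorm alpha p f)%E.
Proof.
move=> n0 k0 fB; have [s s0 fs] := besov_space_seminormE n0 fB.
have [/LfunP_powR[mf fy] _] := fB.
have kM (a : R) : `|k * a| `^ p = k `^ p * `|a| `^ p.
  by rewrite normrM powRM// (ger0_norm k0).
have le : (besov_seminorm alpha p (fun x => (k * f x)%R) <= (k * s)%:E)%E.
  apply: besov_seminorm_le => [|h h0]; first exact: mulr_ge0.
  under eq_integral do rewrite -mulrBr kM.
  rewrite ge0_integralZl_real ?powR_ge0//; last first.
    apply: measurable_powRr_comp; apply: measurableT_comp => //.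
    apply: measurable_funB => //; apply: measurableT_comp => //.
    by apply: measurable_rVD.
  have fle : (besov_seminorm alpha p f <= s%:E)%E by rewrite fs.
  apply: le_trans (lee_wpmul2l _ (le_besov_seminorm s0 fle h)) _.
    by rewrite lee_fin powR_ge0.
  by rewrite -EFinM lee_fin [in leRHS]mulrCA [leRHS]powRM ?mulr_ge0 ?powR_ge0.
split; last by rewrite fs -EFinM.
split; last by rewrite (le_lt_trans le)// ltry.
apply/LfunP_powR; split; first exact: measurable_funM.
under eq_integral do rewrite kM.
rewrite ge0_integralZl_real ?powR_ge0//; last first.
  by apply: measurable_powRr_comp; exact: measurableT_comp.
rewrite lte_mul_pinfty// ?lee_fin ?powR_ge0// ge0_fin_numE//.
Qed.

End besov.

Section besov_maximal.
Context {R : realType} {n : nat}.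
Local Notation mu := (lebesgue_rV n).

Lemma measurable_difference_powR (f : 'rV[R]_n -> R) (h : 'rV[R]_n) (p : R) :
  measurable_fun setT f ->
  measurable_fun setT (fun x : 'rV[R]_n => `|f (x + h) - f x| `^ p).
Proof.
move=> mf; apply: measurable_powRr_comp; apply: measurableT_comp => //.
apply: measurable_funB => //; apply: measurableT_comp => //.
by apply: measurable_rVD.
Qed.

Lemma integral_difference_normr_le (f : 'rV[R]_n -> R) (u : 'rV[R]_n) (p : R) :
  0 <= p -> measurable_fun setT f ->
  (\int[mu]_x (`| `|f (x + u)| - `|f x| | `^ p)%:E <=
   \int[mu]_x (`|f (x + u) - f x| `^ p)%:E)%E.
Proof.
move=> p0 mf.
have mf' : measurable_fun setT (fun x => `|f x|) by exact: measurableT_comp.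
have mdf' := measurable_difference_powR u p mf'.
have mdf := measurable_difference_powR u p mf.
apply: ge0_le_integral; first exact: measurableT.
- by move=> x _; rewrite lee_fin powR_ge0.
- by apply/measurable_EFinP; exact: mdf'.
- by apply/measurable_EFinP; exact: mdf.
- move=> x _; rewrite lee_fin; apply: ler_powR2r; [exact: p0|exact: normr_ge0|].
  exact: ler_dist_dist.
Qed.

Lemma euclidean_norm_powR_le (u : 'rV[R]_n) (alpha t p : R) :
  0 <= alpha -> 0 <= p -> 0 <= t ->
  (euclidean_norm u `^ alpha * t) `^ p <= norm1 u `^ (alpha * p) * t `^ p.
Proof.
move=> alpha0 p0 t0; rewrite (powRM p (powR_ge0 _ _) t0) -powRrM.
rewrite ler_wpM2r ?powR_ge0//.
apply: ler_powR2r; [exact: mulr_ge0|exact: euclidean_norm_ge0|].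
exact: euclidean_norm_le_norm1.
Qed.

Lemma norm1_powR_le (u : 'rV[R]_n) (alpha t p : R) :
  0 <= alpha -> 0 <= p -> 0 <= t ->
  norm1 u `^ (alpha * p) * t `^ p <=
  n%:R `^ (alpha * p) * (euclidean_norm u `^ alpha * t) `^ p.
Proof.
move=> alpha0 p0 t0; rewrite (powRM p (powR_ge0 _ _) t0) -powRrM mulrA.
rewrite ler_wpM2r ?powR_ge0// -powRM ?euclidean_norm_ge0//.
apply: ler_powR2r; [exact: mulr_ge0|exact: norm1_ge0|].
exact: norm1_le_euclidean_norm.
Qed.

(** The order of the quantifiers matters: C precedes both f and c0, so that c0 may later be adapted
    to f and to the level. *)
Lemma besov_dyadic_maximal (alpha p : R) : (0 < n)%N ->
  0 < alpha -> alpha < 1 -> 1 < p ->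
  exists2 C : R, 0 < C & forall f : 'rV[R]_n -> R,
    besov_space alpha p f -> continuous f -> forall c0 : R, 0 < c0 ->
    let g := dyadic_maximal c0 (fun x => `|f x|) in
    [/\ besov_space alpha p g, continuous g,
        forall j x, kernel_average (c0 * 2 ^+ j) (fun x => `|f x|) x <= g x &
        (besov_seminorm alpha p g <= C%:E * besov_seminorm alpha p f)%E].
Proof.
move=> n0 alpha0 alpha1 p1.
have p0 : 0 < p by exact: lt_trans p1.
pose s := alpha * p; have s0 : 0 < s by rewrite mulr_gt0.
have sp : s < p by rewrite gtr_pMl.
(* n^s is the cost of returning from the l1 norm to the Euclidean norm; the absolute value and the
   added 1 make K positive without examining the constant. *)
pose K : R := `|dyadic_maximal_const (n := n) p s| * n%:R `^ s + 1.
have K0 : 0 < K by rewrite ltr_wpDl// mulr_ge0 ?powR_ge0.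
exists (K `^ p^-1); first exact: powR_gt0.
move=> f fB cf c0 c0_gt0.
have [t t0 ft] := besov_space_seminormE n0 fB.
have [/(LfunP_powR p1)[mf fy] _] := fB.
have [f' f'E] : exists f' : 'rV[R]_n -> R, f' = (fun x => `|f x|) by eexists.
have f'x x : f' x = `|f x| by rewrite f'E.
rewrite /= -f'E => {f'E}; set g := dyadic_maximal c0 f'.
pose B := t `^ p.
have mf' : measurable_fun setT f'.
  by rewrite (_ : f' = Num.norm \o f); [exact: measurableT_comp|exact/funext].
have f'0 x : 0 <= f' x by rewrite f'x.
have cf' : continuous f'.
  apply/continuous_rVP => x e e0; have := (continuous_rVP f).1 cf x e e0.
  by apply: filterS => y; apply: le_trans; rewrite !f'x; exact: ler_dist_dist.
have intE : (\int[mu]_x (`|f' x| `^ p)%:E = \int[mu]_x (`|f x| `^ p)%:E)%E.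
  by apply: eq_integral => x _; rewrite f'x normr_id.
have int0 : (0 <= \int[mu]_x (`|f x| `^ p)%:E)%E.
  by apply: integral_ge0 => x _; rewrite lee_fin powR_ge0.
have intfin : (\int[mu]_x (`|f x| `^ p)%:E)%E \is a fin_num.
  by rewrite (ge0_fin_numE int0); exact: fy.
have f'P : (\int[mu]_x (`|f' x| `^ p)%:E =
    (fine (\int[mu]_x (`|f x| `^ p)%:E)%E)%:E)%E.
  exact: etrans intE (esym (fineK intfin)).
have fle : (besov_seminorm alpha p f <= t%:E)%E by rewrite ft.
have B0 : 0 <= B by exact: powR_ge0.
have f'B u : (\int[mu]_x (`|f' (x + u)%R - f' x| `^ p)%:E <=
    (norm1 u `^ s * B)%:E)%E.
  under eq_integral do rewrite !f'x.
  apply: le_trans (integral_difference_normr_le u (ltW p0) mf) _.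
  apply: le_trans (le_besov_seminorm p1 t0 fle u) _; rewrite lee_fin.
  exact: euclidean_norm_powR_le (ltW alpha0) (ltW p0) t0.
have gle : (besov_seminorm alpha p g <= (K `^ p^-1 * t)%:E)%E.
  apply: (besov_seminorm_le p1) => [|h h0]; first by rewrite mulr_ge0 ?powR_ge0.
  have := integral_dyadic_maximal_difference_powR p1 s0 sp mf' f'P cf' f'0 B0
    f'B c0_gt0 h0.
  move=> /le_trans; apply; rewrite lee_fin.
  set H := euclidean_norm h `^ alpha.
  have H0 : 0 <= H by exact: powR_ge0.
  rewrite [in leRHS]mulrCA [leRHS]powRM ?powR_ge0 ?mulr_ge0//.
  rewrite -(powRrM K) mulVf ?gt_eqF// (powRr1 (ltW K0)).
  apply: le_trans (_ : `|dyadic_maximal_const (n := n) p s| *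
      (n%:R `^ s * (H * t) `^ p) <= _).
    apply: le_trans (ler_wpM2l (normr_ge0 _)
      (norm1_powR_le h (ltW alpha0) (ltW p0) t0)).
    by rewrite ler_wpM2r ?ler_norm// mulr_ge0 ?powR_ge0.
  rewrite mulrA ler_wpM2r ?powR_ge0//.
  by rewrite /K lerDl.
have gy := integral_dyadic_maximal_powR_lty p1 s0 mf' f'P cf' f'0 B0 f'B c0_gt0.
have mg : measurable_fun setT g.
  exact: measurable_dyadic_maximal p1 mf' f'P cf' f'0 _ c0_gt0.
split.
- split; first exact/(LfunP_powR p1).
  by rewrite (le_lt_trans gle)// ltry.
- exact: (continuous_dyadic_maximal p1 mf' f'P cf' f'0 c0_gt0).
- move=> j x.
  exact: (dyadic_average_le_maximal p1 mf' f'P cf' f'0 c0_gt0 j.+1).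
- by rewrite ft -EFinM.
Qed.

End besov_maximal.

(** * The heat extension on tents *)

Section heat.
Context {R : realType} {n : nat}.
Implicit Types (f : 'rV[R]_n -> R) (x y u : 'rV[R]_n) (c t : R).
Local Notation mu := (lebesgue_rV n).

(** 4^n compares the prefactors; the exponent is the n^2 from completing the square plus the n that
    pays for moving the centre from y to x. *)
Definition heat_kernel_const : R := 4 ^+ n * expR (n%:R ^+ 2 + n%:R).

Lemma heat_kernel_const_gt0 : 0 < heat_kernel_const.
Proof. by rewrite mulr_gt0 ?expR_gt0// exprn_gt0. Qed.

Lemma pi_ge1 : 1 <= pi :> R.
Proof. by have := pi_ge2 R; lra. Qed.

Let powR_natV2 t : 0 <= t -> (t ^+ 2) `^ (n%:R / 2) = t ^+ n.
Proof.
move=> t0; rewrite -powR_mulrn// -powRrM -powR_mulrn//; congr (_ `^ _).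
by rewrite mulrCA divff ?mulr1.
Qed.

(** 4 * pi >= 1 leaves t^(- n), and 1 / t <= 2 * c turns this into 4^n * (c / 2)^n. *)
Lemma heat_prefactor_le c t : 0 < t -> 0 < c -> 1 <= 2 * c * t ->
  (4 * pi * t ^+ 2) `^ (- (n%:R / 2)) <= 4 ^+ n * (c / 2) ^+ n.
Proof.
move=> t0 c0 ct; rewrite powRN -exprMn.
have tn : 0 < t ^+ n by rewrite exprn_gt0.
apply: (@le_trans _ _ (t ^+ n)^-1).
  rewrite lef_pV2 ?posrE ?powR_gt0 ?mulr_gt0 ?pi_gt0 ?exprn_gt0//.
  rewrite -powR_natV2 ?(ltW t0)//; apply: ler_powR2r;
    [by rewrite divr_ge0|exact: sqr_ge0|].
  by rewrite ler_peMl ?sqr_ge0//; have := pi_ge1; lra.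
rewrite -exprVn; apply: lerXn2r; rewrite ?nnegrE ?invr_ge0 ?(ltW t0)//.
  by rewrite mulr_ge0// divr_ge0// ltW.
rewrite -[t^-1]mul1r ler_pdivrMr//; lra.
Qed.

(** With s = |y - u| / t, the exponent c |u - x|_1 is at most n * (s + 1), linear in s, and the
    Gaussian exponent s^2 / 4 dominates it up to a constant. The window 1/2 <= c * t <= 1 spans a
    factor 2, so dyadic scales always meet it. *)
Lemma heat_kernel_le c t x y u : 0 < t -> 0 < c -> c * t <= 1 -> 1 <= 2 * c * t ->
  euclidean_norm (x - y) < t ->
  (4 * pi * t ^+ 2) `^ (- (n%:R / 2)) *
    expR (- (euclidean_norm (y - u) ^+ 2 / (4 * t ^+ 2))) <=
  heat_kernel_const * expkernel c (u - x).
Proof.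
move=> t0 c0 ct ct2 xy.
rewrite /heat_kernel_const expkernelE [leRHS]mulrACA -expRD.
apply: ler_pM; rewrite ?powR_ge0 ?expR_ge0//.
  exact: heat_prefactor_le.
rewrite ler_expR; set r := euclidean_norm (y - u).
have r0 : 0 <= r by exact: euclidean_norm_ge0.
have -> : r ^+ 2 / (4 * t ^+ 2) = (r / t) ^+ 2 / 4 by field; rewrite gt_eqF.
have h : norm1 (u - x) <= n%:R * (r + t).
  have := norm1D (u - y) (y - x); rewrite addrA subrK => /le_trans; apply.
  rewrite mulrDr lerD//.
    by rewrite norm1_distC; exact: norm1_le_euclidean_norm.
  rewrite norm1_distC (le_trans (norm1_le_euclidean_norm _))//.
  by rewrite ler_wpM2l// ltW.
have ch : c * norm1 (u - x) <= n%:R * (r / t + 1).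
  apply: (@le_trans _ _ (t^-1 * (n%:R * (r + t)))).
    apply: ler_pM; rewrite ?(ltW c0) ?norm1_ge0//.
    by rewrite -[t^-1]mul1r ler_pdivlMr.
  rewrite le_eqVlt; apply/orP; left; apply/eqP; field; rewrite gt_eqF//.
(* - s^2/4 <= n^2 - n s for s = r / t *)
have := sqr_ge0 (r / t / 2 - n%:R : R); lra.
Qed.

(** The heat kernel at time t^2 is bounded below on the cube of half-side t / (n + 1) around y,
    which lies in B(y, t); the powers of t cancel. *)
Definition heat_ball_const : R :=
  (4 * pi) `^ (- (n%:R / 2)) * (expR (- 4^-1) * (2 / n.+1%:R) ^+ n).

Lemma heat_ball_const_gt0 : 0 < heat_ball_const.
Proof.
by rewrite mulr_gt0 ?powR_gt0 ?mulr_gt0 ?expR_gt0 ?pi_gt0.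
Qed.

Section heat_bounds.
Variables (p : R) (f : 'rV[R]_n -> R) (P : R).
Hypotheses (p1 : 1 < p) (mf : measurable_fun setT f).
Hypothesis fP : (\int[mu]_y (`|f y| `^ p)%:E = P%:E)%E.

Let gauss t y u : R := expR (- (euclidean_norm (y - u) ^+ 2 / (4 * t ^+ 2))).

Let mgauss t y : measurable_fun setT (gauss t y).
Proof.
apply: measurableT_comp => //; apply: measurable_funN; apply: measurable_funM => //.
rewrite (_ : (fun u => _) = fun u => \sum_i (y - u) ord0 i ^+ 2); last first.
  by apply/funext => u; rewrite sqr_sqrtr// sumr_ge0// => i _; exact: sqr_ge0.
apply: measurable_sum => i; apply: measurable_funX.
apply: measurableT_comp (@measurable_rV_coord _ _ n i) _.
exact: measurable_rVB.
Qed.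

Let mnf : measurable_fun setT (fun u => `|f u|).
Proof. exact: measurableT_comp. Qed.

Let nfP : (\int[mu]_y (`| `|f y| | `^ p)%:E = P%:E)%E.
Proof. by rewrite -fP; apply: eq_integral => y _; rewrite normr_id. Qed.

(** Domination by the exponential kernel of rate 1 / t with the same centre. *)
Lemma integrable_gauss t y : 0 < t ->
  mu.-integrable setT (EFin \o (fun u => gauss t y u * f u)).
Proof.
move=> t0; set k := (4 * pi * t ^+ 2) `^ (- (n%:R / 2)).
have k0 : 0 < k by rewrite powR_gt0// !mulr_gt0 ?pi_gt0 ?exprn_gt0.
have c0 : 0 < t^-1 by rewrite invr_gt0.
have iA := integrable_kernelM p1 mnf nfP y c0.
apply: (le_integrable measurableT _ _
  (integrableZl measurableT (k^-1 * heat_kernel_const) iA)).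
  by apply/measurable_EFinP; exact: measurable_funM.
move=> u _ /=; rewrite lee_fin [leLHS]normrM (gtr0_norm (expR_gt0 _)).
apply: le_trans (ler_norm _); rewrite [leRHS]mulrA ler_wpM2r//.
rewrite -[leRHS]mulrA ler_pdivlMl//.
apply: heat_kernel_le; rewrite ?mulVf ?gt_eqF//.
- by rewrite -mulrA mulVf ?gt_eqF// mulr1 ler1n.
- rewrite subrr /euclidean_norm big1 ?sqrtr0// => i _.
  by rewrite mxE expr0n.
Qed.

Lemma normr_heat_extension_le c t x y : 0 < t -> 0 < c ->
  c * t <= 1 -> 1 <= 2 * c * t -> euclidean_norm (x - y) < t ->
  `|heat_extension f (t ^+ 2) y| <=
  heat_kernel_const * kernel_average c (fun u => `|f u|) x.
Proof.
move=> t0 c0 ct ct2 xy; rewrite /heat_extension normrM.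
set k := (4 * pi * t ^+ 2) `^ (- (n%:R / 2)).
have k0 : 0 < k by rewrite powR_gt0// !mulr_gt0 ?pi_gt0 ?exprn_gt0.
rewrite (gtr0_norm k0).
have iG := integrable_gauss y t0.
have iA := integrable_kernelM p1 mnf nfP x c0.
apply: le_trans (ler_wpM2l (ltW k0) (le_normr_Rintegral measurableT iG)) _.
have iGn : mu.-integrable setT (EFin \o (fun u => `|gauss t y u * f u|)).
  by have := integrable_abse iG; exact: eq_integrable.
rewrite -(RintegralZl k measurableT iGn).
rewrite -(RintegralZl heat_kernel_const measurableT iA).
apply: le_Rintegral => //.
- by have := integrableZl measurableT k iGn; exact: eq_integrable.
- by have := integrableZl measurableT heat_kernel_const iA; exact: eq_integrable.
- move=> u _; rewrite normrM (gtr0_norm (expR_gt0 _)) [leLHS]mulrA.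
  rewrite [leRHS]mulrA; apply: (ler_wpM2r (normr_ge0 (f u))).
  exact: (heat_kernel_le u t0 c0 ct ct2 xy).
Qed.

Lemma lebesgue_rV_cube y (r : R) : 0 <= r ->
  mu [set u | forall i, `](y ord0 i - r), (y ord0 i + r)[%classic (u ord0 i)] =
  ((2 * r) ^+ n)%:E.
Proof.
move=> r0; rewrite (lebesgue_rV_box
  (A := fun i => `](y ord0 i - r), (y ord0 i + r)[%classic))//.
rewrite (eq_bigr (fun=> (2 * r)%:E)); last first.
  move=> i _; rewrite lebesgue_measure_itv/= lte_fin.
  case: ifPn => [_|]; first by rewrite -EFinB; congr EFin; ring.
  by rewrite -leNgt => yr; congr EFin; lra.
by rewrite prodEFin big_const_ord iter_mulr_1.
Qed.

Lemma heat_extension_ge t y : 0 < t -> (forall u, 0 <= f u) ->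
  (forall u, euclidean_norm (u - y) < t -> 1 <= f u) ->
  heat_ball_const <= heat_extension f (t ^+ 2) y.
Proof.
move=> t0 f0 f1; rewrite /heat_extension.
set k := (4 * pi * t ^+ 2) `^ (- (n%:R / 2)).
have k0 : 0 < k by rewrite powR_gt0// !mulr_gt0 ?pi_gt0 ?exprn_gt0.
pose r : R := t / n.+1%:R; have r0 : 0 < r by rewrite divr_gt0.
pose D := [set u : 'rV[R]_n |
  forall i, `](y ord0 i - r), (y ord0 i + r)[%classic (u ord0 i)].
have mD : measurable D.
  by apply: (measurable_box
    (A := fun i => `](y ord0 i - r), (y ord0 i + r)[%classic)) => i.
have Dt u : D u -> euclidean_norm (u - y) < t.
  move=> Du; apply: (le_lt_trans (euclidean_norm_le_norm1 _)).
  apply: (@le_lt_trans _ _ (\sum_(i < n) r)).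
    apply: ler_sum => i _; have := Du i; rewrite /= in_itv/= !mxE => /andP[? ?].
    by rewrite ler_norml; apply/andP; split; lra.
  rewrite sumr_const card_ord -[X in X < _]mulr_natr /r -mulrA gtr_pMr//.
  by rewrite mulrC ltr_pdivrMr// mul1r ltr_nat.
have kE : heat_ball_const = k * (expR (- 4^-1) * (2 * r) ^+ n).
  have -> : k = (4 * pi) `^ (- (n%:R / 2)) * (t ^+ n)^-1.
    rewrite /k powRM ?sqr_ge0 ?mulr_ge0 ?pi_ge0//.
    by rewrite (powRN (t ^+ 2)) powR_natV2 ?(ltW t0).
  rewrite /heat_ball_const -mulrA; congr (_ * _); rewrite mulrCA; congr (_ * _).
  have -> : 2 * r = 2 / n.+1%:R * t by rewrite /r mulrCA mulrC.
  by rewrite [in RHS]exprMn mulrCA mulVf ?mulr1// expf_neq0// gt_eqF.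
rewrite kE ler_wpM2l ?(ltW k0)// -lee_fin.
rewrite /Rintegral fineK; last first.
  by apply: integrable_fin_num => //; exact: integrable_gauss.
have gf0 u : 0 <= gauss t y u * f u by rewrite mulr_ge0 ?expR_ge0.
have mgf : measurable_fun setT (fun u => gauss t y u * f u).
  exact: measurable_funM.
apply: (@le_trans _ _ (\int[mu]_(u in D) (gauss t y u * f u)%:E)%E); last first.
  apply: ge0_subset_integral => //; first exact/measurable_EFinP.
  by move=> u _; rewrite lee_fin.
rewrite EFinM -(lebesgue_rV_cube y (ltW r0)) -integral_cst//.
apply: ge0_le_integral => //.
- by move=> u _; rewrite lee_fin expR_ge0.
- by apply: measurable_funTS; exact/measurable_EFinP.
- move=> u Du; rewrite lee_fin -[leLHS]mulr1; apply: ler_pM => //.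
  + rewrite ler_expR lerN2 invfM mulrCA -[leRHS]mulr1 ler_wpM2l//.
    have e0 := euclidean_norm_ge0 (y - u).
    have et : euclidean_norm (y - u) <= t.
      by rewrite euclidean_norm_distC ltW// Dt.
    rewrite ler_pdivrMr ?exprn_gt0// mul1r.
    by apply: lerXn2r; rewrite ?nnegrE// ltW.
  + by apply: f1; exact: Dt.
Qed.

End heat_bounds.

End heat.

(** * Superlevel sets of the heat extension and tents *)

Section tents.
Context {R : realType} {n : nat}.
Local Notation mu := (lebesgue_rV n).

Lemma dyadic_scale (a : R) : 1 <= a -> exists j, 2 ^+ j <= a <= 2 * 2 ^+ j.
Proof.
move=> a1; have a0 : 0 <= a by lra.
have ex : exists j, a < 2 ^+ j.
  exists (Num.bound a); apply: lt_le_trans (archi_boundP a0) _.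
  by rewrite -natrX ler_nat ltnW// ltn_expl.
(* The least k with a < 2^k is not 0 because a >= 1; its predecessor is the required exponent. *)
case: (ex_minnP ex) => -[|j] aj minj; first by move: aj; rewrite expr0; lra.
exists j; rewrite -exprS (ltW aj) andbT leNgt.
by apply/negP => /minj; rewrite ltnn.
Qed.

Lemma heat_extension_small (p : R) (f : 'rV[R]_n -> R) (P lambda : R) :
  (0 < n)%N -> 1 < p -> measurable_fun setT f ->
  (\int[mu]_y (`|f y| `^ p)%:E = P%:E)%E -> 0 < lambda ->
  exists2 c0 : R, 0 < c0 & forall t y, 0 < t -> 1 < c0 * t ->
    `|heat_extension f (t ^+ 2) y| <= lambda.
Proof.
move=> n0 p1 mf fP l0.
have P0 : 0 <= P.
  by rewrite -lee_fin -fP; apply: integral_ge0 => x _; rewrite lee_fin powR_ge0.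
set H : R := heat_kernel_const (n := n).
have H0 : 0 < H by exact: heat_kernel_const_gt0.
(* Chosen so that H * e is half of the level; the other half is left for the term that decays with
   t. *)
pose e := lambda / 2 / H; have e0 : 0 < e by rewrite !divr_gt0.
pose M := H * (e `^ (1 - p) * P).
have M0 : 0 <= M by rewrite !mulr_ge0 ?powR_ge0// ltW.
have M1 : 0 < M + 1 by lra.
have lM : 0 < lambda / 2 / (M + 1) by rewrite !divr_gt0.
(* The minimum with 1 gives c0^n <= c0 for n >= 1, so the decaying term is at most M * c0 <= lambda
   / 2. *)
exists (Num.min 1 (lambda / 2 / (M + 1))); first by rewrite lt_min ltr01.
set c0 := Num.min _ _ => t y t0 ct.
have c0_gt0 : 0 < c0 by rewrite lt_min ltr01.
have tV0 : 0 < t^-1 by rewrite invr_gt0.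
have tVc : t^-1 <= c0 by rewrite -[t^-1]mul1r ler_pdivrMr// ltW.
have mnf : measurable_fun setT (fun u => `|f u|) by exact: measurableT_comp.
have nfP : (\int[mu]_y (`| `|f y| | `^ p)%:E = P%:E)%E.
  by rewrite -fP; apply: eq_integral => u _; rewrite normr_id.
have yy : euclidean_norm (y - y) < t.
  rewrite subrr /euclidean_norm big1 ?sqrtr0// => i _; by rewrite mxE expr0n.
have tt1 : t^-1 * t <= 1 by rewrite mulVf ?gt_eqF.
have tt2 : 1 <= 2 * t^-1 * t by rewrite -mulrA mulVf ?gt_eqF// mulr1 ler1n.
apply: le_trans (normr_heat_extension_le p1 mf fP t0 tV0 tt1 tt2 yy) _.
have av := kernel_average_le p1 mnf nfP (fun u => normr_ge0 (f u)) y tV0 e0.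
apply: le_trans (ler_wpM2l (ltW H0) av) _.
have tn : (t^-1 / 2) ^+ n <= c0.
  case: n n0 => // m _; apply: (@le_trans _ _ (c0 ^+ m.+1)).
    apply: lerXn2r; rewrite ?nnegrE ?divr_ge0 ?(ltW tV0) ?(ltW c0_gt0)//.
    by rewrite ler_pdivrMr// (le_trans tVc)// ler_peMr ?(ltW c0_gt0)// ler1n.
  rewrite exprS ler_piMr ?(ltW c0_gt0)// exprn_ile1 ?(ltW c0_gt0)//.
  by rewrite ge_min lexx.
have -> : lambda = H * e + lambda / 2.
  by rewrite /e mulrC divfK ?gt_eqF// -splitr.
rewrite mulrDr lerD2l.
have -> : H * (e `^ (1 - p) * ((t^-1 / 2) ^+ n * P)) = M * (t^-1 / 2) ^+ n.
  by rewrite /M; ring.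
apply: (@le_trans _ _ ((M + 1) * c0)).
  by apply: ler_pM => //; [rewrite exprn_ge0// divr_ge0// ltW|lra].
by rewrite mulrC -ler_pdivlMr// ge_min lexx orbT.
Qed.

(** At a point of the superlevel set t cannot exceed 1 / c0, so some scale c0 * 2^j matches t. The
    average at that scale around any x in B(y, t) then exceeds the level up to the kernel
    constant. *)
Lemma superlevel_sub_tent (p : R) (f g : 'rV[R]_n -> R) (P lambda c0 : R) :
  1 < p -> measurable_fun setT f ->
  (\int[mu]_y (`|f y| `^ p)%:E = P%:E)%E -> 0 < c0 ->
  (forall j x, kernel_average (c0 * 2 ^+ j) (fun x => `|f x|) x <= g x) ->
  (forall t y, 0 < t -> 1 < c0 * t -> `|heat_extension f (t ^+ 2) y| <= lambda) ->
  [set z : {posnum R} * 'rV[R]_n |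
     lambda < `|heat_extension f (z.1%:num ^+ 2) z.2|] `<=`
  tent [set x | lambda < heat_kernel_const (n := n) * g x].
Proof.
move=> p1 mf fP c0_gt0 fg small [t y] /= lw x /= xy.
have t0 : 0 < t%:num by [].
have ct0 : 0 < c0 * t%:num by rewrite mulr_gt0.
have [ct|/small] := leP (c0 * t%:num) 1; last first.
  by move=> /(_ y t0) => /le_lt_trans /(_ lw); rewrite ltxx.
have [|j /andP[j1 j2]] := @dyadic_scale (c0 * t%:num)^-1.
  by rewrite invf_ge1.
apply: (lt_le_trans lw).
have cj : 0 < c0 * 2 ^+ j by rewrite mulr_gt0// exprn_gt0.
apply: le_trans (normr_heat_extension_le p1 mf fP t0 cj _ _ xy) _.
- by rewrite mulrAC mulrC -ler_pdivlMr// mul1r.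
- rewrite (_ : 2 * (c0 * 2 ^+ j) * t%:num = 2 * 2 ^+ j * (c0 * t%:num));
    last by ring.
  by rewrite -ler_pdivrMr// mul1r.
- by rewrite ler_wpM2l// ltW// heat_kernel_const_gt0.
Qed.

Lemma open_superlevel (g : 'rV[R]_n -> R) (a : R) :
  continuous g -> open [set x | a < g x].
Proof.
move=> cg; rewrite openE => x /= ax.
have e0 : 0 < (g x - a) / 2 by rewrite divr_gt0// subr_gt0.
have := (continuous_rVP g).1 cg x _ e0; apply: filterS => y /=.
by rewrite ler_norml => /andP[_]; lra.
Qed.

Lemma besov_normr (alpha p : R) (f : 'rV[R]_n -> R) : (0 < n)%N -> 1 < p ->
  besov_space alpha p f ->
  besov_space alpha p (fun x => `|f x|) /\
  (besov_seminorm alpha p (fun x => `|f x|%R) <= besov_seminorm alpha p f)%E.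
Proof.
move=> n0 p1 fB; have [s s0 fs] := besov_space_seminormE n0 fB.
have [/(LfunP_powR p1)[mf fy] _] := fB.
have fle : (besov_seminorm alpha p f <= s%:E)%E by rewrite fs.
have le : (besov_seminorm alpha p (fun x => `|f x|%R) <= s%:E)%E.
  apply: (besov_seminorm_le p1) => // h h0.
  apply: le_trans (le_besov_seminorm p1 s0 fle h).
  by apply: integral_difference_normr_le => //; lra.
split; last by rewrite fs.
split; last by rewrite (le_lt_trans le)// ltry.
apply/(LfunP_powR p1); split; first exact: measurableT_comp.
by under eq_integral do rewrite normr_id.
Qed.

End tents.

(** * Capacity of superlevel sets and powers of the infimum *)

Section capacity.
Context {R : realType} {n : nat}.

Lemma continuous_scale (g : 'rV[R]_n -> R) (k : R) :
  continuous g -> continuous (fun x => k * g x).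
Proof.
move=> cg; apply/continuous_rVP => x e e0.
have k1 : 0 < `|k| + 1 by rewrite ltr_wpDl.
have e1 : 0 < e / (`|k| + 1) by rewrite divr_gt0.
have := (continuous_rVP g).1 cg x _ e1; apply: filterS => y h.
rewrite -mulrBr normrM; apply: le_trans (ler_wpM2l (normr_ge0 k) h) _.
by rewrite mulrCA ler_piMr ?(ltW e0)// ler_pdivrMr// mul1r lerDl.
Qed.

(** The competitor is k / lambda * g, which is at least 1 on the superlevel set; that set is open
    and serves as its own neighbourhood. *)
Lemma capacity_superlevel_le (alpha p : R) (g : 'rV[R]_n -> R) (lambda k M : R) :
  (0 < n)%N -> 1 < p -> 0 < lambda -> 0 < k -> 0 <= M ->
  besov_space alpha p g -> continuous g ->
  (besov_seminorm alpha p g <= M%:E)%E ->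
  (besov_capacity alpha p [set x | (lambda < k * g x)%R]
    <= ((k / lambda * M) `^ p)%:E)%E.
Proof.
move=> n0 p1 l0 k0 M0 gB cg gM.
have p0 : 0 <= p by lra.
have kl0 : 0 <= k / lambda by rewrite divr_ge0// ltW.
have [kgB kgM] := besov_scale p1 n0 kl0 gB.
have kg_ge0 := besov_seminorm_ge0 alpha p (fun x => k / lambda * g x) n0.
apply: le_trans
  (_ : (besov_seminorm alpha p (fun x => (k / lambda * g x)%R) `^ p <= _)%E).
  apply: ereal_inf_lbound; exists (fun x => k / lambda * g x) => //.
  split=> //; first exact: continuous_scale.
  exists [set x | lambda < k * g x]; split=> //.
    by apply: open_superlevel; exact: continuous_scale.
  by move=> x /= lx; rewrite mulrAC ler_pdivlMr// mul1r ltW.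
rewrite -poweR_EFin; apply: gt0_ler_poweR => //.
- by rewrite in_itv/= leey andbT.
- by rewrite in_itv/= leey andbT lee_fin mulr_ge0.
- by apply: le_trans kgM _; rewrite [leRHS]EFinM lee_wpmul2l// lee_fin.
Qed.

(** The power q / p is moved to the other side as p / q, where the bound becomes a lower bound for
    every competitor and hence for the infimum. An empty admissible class, of capacity +oo, needs no
    separate case. *)
Lemma le_capacity_poweR (alpha p q K : R) (E : set 'rV[R]_n) (v : \bar R) :
  (0 < n)%N -> 0 < p -> 0 < q -> 0 < K -> (0 <= v)%E ->
  (forall f, besov_admissible alpha p E f ->
     (v <= K%:E * besov_seminorm alpha p f `^ q)%E) ->
  (v <= K%:E * besov_capacity alpha p E `^ (q / p))%E.
Proof.
move=> n0 p0 q0 K0 v0 vK; rewrite -lee_pdivrMl//.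
have KV0 : (0 <= K^-1%:E)%E by rewrite lee_fin invr_ge0 ltW.
have Kv0 : (0 <= K^-1%:E * v)%E by exact: mule_ge0.
have pq0 : 0 <= p / q by rewrite divr_ge0// ltW.
have qp0 : 0 <= q / p by rewrite divr_ge0// ltW.
have pqK : p / q * (q / p) = 1 by field; rewrite !gt_eqF.
have le_cap : ((K^-1%:E * v) `^ (p / q) <= besov_capacity alpha p E)%E.
  apply: le_ereal_inf_tmp => _ [f fE <-].
  have S0 := besov_seminorm_ge0 alpha p f n0.
  have -> : (besov_seminorm alpha p f `^ p =
      (besov_seminorm alpha p f `^ q) `^ (p / q))%E.
    by rewrite -poweRrM mulrCA mulfV ?mulr1// gt_eqF.
  apply: gt0_ler_poweR => //; rewrite ?in_itv/= ?leey ?andbT ?poweR_ge0//.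
  by rewrite lee_pdivrMl//; exact: vK.
have -> : (K^-1%:E * v = ((K^-1%:E * v) `^ (p / q)) `^ (q / p))%E.
  by rewrite -poweRrM pqK poweRe1.
apply: gt0_ler_poweR => //.
- by rewrite in_itv/= leey andbT poweR_ge0.
- rewrite in_itv/= leey andbT; apply: le_trans le_cap; exact: poweR_ge0.
Qed.

End capacity.

Theorem proposition7 (R : realType) (n : nat) (alpha p q : R)
    (nu : {outer_measure set ({posnum R} * 'rV[R]_n) -> \bar R})
    (n_ge1 : (1 <= n)%N) (alpha_gt0 : 0 < alpha) (alpha_lt1 : alpha < 1)
    (p_gt1 : 1 < p) (p_lt : p < n%:R / alpha) (q_ge1 : 1 <= q) :
  (exists2 c : R, 0 < c &
     forall f : 'rV[R]_n -> R, besov_space alpha p f -> continuous f ->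
       (ereal_sup
          [set ((lambda `^ q)%:E *
                nu [set z | (lambda <
                             `|heat_extension f (z.1%:num ^+ 2) z.2|)%R])
               `^ q^-1 | lambda in [set lambda : R | (0 < lambda)%R]]
        <= c%:E * besov_seminorm alpha p f)%E)
  <->
  (exists2 c : R, 0 < c &
     forall O : set 'rV[R]_n, open O ->
       (nu (tent O) <= c%:E * besov_capacity alpha p O `^ (q / p))%E).
Proof.
have p0 : 0 < p by exact: lt_trans p_gt1.
have q0 : 0 < q by exact: lt_le_trans q_ge1.
have q_neq0 : q != 0 by rewrite gt_eqF.
split=> -[c c0 hc].
(* The superlevel sets are defined by a strict inequality, so the level lies strictly below the
   lower bound on the tent. The weak-type estimate is used at this single level. *)
- pose l : R := heat_ball_const (n := n) / 2.
  have l0 : 0 < l by rewrite divr_gt0// heat_ball_const_gt0.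
  have lq0 : 0 < l `^ q by rewrite powR_gt0.
  exists ((l `^ q)^-1 * c `^ q); first by rewrite mulr_gt0 ?invr_gt0 ?powR_gt0.
  move=> O oO; apply: le_capacity_poweR => //;
    [by rewrite mulr_gt0 ?invr_gt0 ?powR_gt0|exact: outer_measure_ge0|].
  move=> f [fB cf [N [oN ON fN]]].
  (* An admissible f may be negative away from N; |f| is still at least 1 on N, is nonnegative and
     has no larger seminorm. *)
  have [nfB nfle] := besov_normr n_ge1 p_gt1 fB.
  have cnf : continuous (fun x => `|f x|).
    apply/continuous_rVP => x e e0.
    have := (continuous_rVP f).1 cf x e e0; apply: filterS => y.
    by apply: le_trans; exact: ler_dist_dist.
  have [/(LfunP_powR p_gt1)[mnf nfy] _] := nfB.
  have nfP : (\int[lebesgue_rV n]_x (`| `|f x| | `^ p)%:E =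
      (fine (\int[lebesgue_rV n]_x (`| `|f x| | `^ p)%:E)%E)%:E)%E.
    rewrite fineK// ge0_fin_numE//; apply: integral_ge0 => x _.
    by rewrite lee_fin powR_ge0.
  pose E := [set z : {posnum R} * 'rV[R]_n |
    l < `|heat_extension (fun x => `|f x|) (z.1%:num ^+ 2) z.2|].
  have tE : tent O `<=` E.
    move=> [t y] /= tO; rewrite /E /=.
    apply: (@lt_le_trans _ _ (heat_ball_const (n := n))).
      by rewrite /l ltr_pdivrMr// ltr_pMr ?ltr1n// heat_ball_const_gt0.
    apply: le_trans (ler_norm _).
    apply: (heat_extension_ge p_gt1 mnf nfP) => // u uy.
    by apply: le_trans (fN u _) (ler_norm _); apply: ON; apply: tO.
  apply: le_trans (le_outer_measure nu _ _ tE) _.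
  have nuE0 : (0 <= (l `^ q)%:E * nu E)%E.
    by rewrite mule_ge0 ?outer_measure_ge0// lee_fin ltW.
  have S0 := besov_seminorm_ge0 alpha p f n_ge1.
  have cS0 : (0 <= c%:E * besov_seminorm alpha p f)%E.
    by rewrite mule_ge0// lee_fin ltW.
  have hE : (((l `^ q)%:E * nu E) `^ q^-1 <= c%:E * besov_seminorm alpha p f)%E.
    apply: le_trans (lee_wpmul2l _ nfle); last by rewrite lee_fin ltW.
    by apply: le_trans (hc _ nfB cnf); apply: ereal_sup_ubound; exists l.
  have : (((l `^ q)%:E * nu E) `^ q^-1 `^ q <=
      (c%:E * besov_seminorm alpha p f) `^ q)%E.
    by apply: gt0_ler_poweR hE; rewrite ?in_itv/= ?leey ?andbT ?poweR_ge0// ltW.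
  rewrite -poweRrM mulVf// (poweRe1 nuE0) poweRM// ?lee_fin ?(ltW c0)//.
  by rewrite poweR_EFin -lee_pdivlMl// muleA -EFinM.
- have [C C0 hC] := besov_dyadic_maximal n_ge1 alpha_gt0 alpha_lt1 p_gt1.
  pose H : R := heat_kernel_const (n := n).
  have H0 : 0 < H by exact: heat_kernel_const_gt0.
  have HC0 : 0 < H * C by rewrite mulr_gt0.
  exists (c `^ q^-1 * (H * C)); first by rewrite mulr_gt0// powR_gt0.
  move=> f fB cf.
  have [s s0 fs] := besov_space_seminormE n_ge1 fB.
  have [/(LfunP_powR p_gt1)[mf fy] _] := fB.
  have int0 : (0 <= \int[lebesgue_rV n]_x (`|f x| `^ p)%:E)%E.
    by apply: integral_ge0 => x _; rewrite lee_fin powR_ge0.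
  have fP : (\int[lebesgue_rV n]_x (`|f x| `^ p)%:E =
      (fine (\int[lebesgue_rV n]_x (`|f x| `^ p)%:E)%E)%:E)%E.
    by apply/esym/fineK; rewrite (ge0_fin_numE int0).
  apply: ge_ereal_sup => _ [lambda /= l0 <-].
  have [c1 c1_gt0 small] := heat_extension_small n_ge1 p_gt1 mf fP l0.
  (* c1 depends on the level, but C does not, so the final constant is uniform over the levels. *)
  have /= [gB cg avg gs] := hC f fB cf c1 c1_gt0.
  set g := dyadic_maximal _ _ in gB cg avg gs.
  have sub := superlevel_sub_tent p_gt1 mf fP c1_gt0 avg small.
  set E := [set z | _] in sub *.
  pose O := [set x | lambda < H * g x].
  have oO : open O by apply: open_superlevel; exact: continuous_scale.
  have Cs0 : 0 <= C * s by rewrite mulr_ge0// ltW.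
  rewrite fs -EFinM in gs.
  have cap := capacity_superlevel_le n_ge1 p_gt1 l0 H0 Cs0 gB cg gs.
  have cap0 : (0 <= besov_capacity alpha p O)%E.
    by apply: le_ereal_inf_tmp => _ [u _ <-]; exact: poweR_ge0.
  have qp0 : 0 <= q / p by rewrite divr_ge0 ?ltW.
  have HCs0 : 0 <= H / lambda * (C * s) by rewrite mulr_ge0// divr_ge0 ?ltW.
  have nuE : (nu E <= (c * (H / lambda * (C * s)) `^ q)%:E)%E.
    apply: le_trans (le_outer_measure nu _ _ sub) _.
    apply: le_trans (hc O oO) _.
    rewrite EFinM lee_wpmul2l ?lee_fin ?(ltW c0)//.
    have -> : (H / lambda * (C * s)) `^ q =
        ((H / lambda * (C * s)) `^ p) `^ (q / p).
      by rewrite -powRrM (mulrCA p) mulfV ?mulr1// gt_eqF.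
    rewrite -poweR_EFin; apply: gt0_ler_poweR cap => //;
      by rewrite in_itv/= leey andbT ?lee_fin ?powR_ge0.
  have lq0 : 0 < lambda `^ q by rewrite powR_gt0.
  (* The capacity of the superlevel set scales like lambda^(- p), so its power q / p cancels
     lambda^q exactly. *)
  have lnuE : ((lambda `^ q)%:E * nu E <= (c * (H * C * s) `^ q)%:E)%E.
    have lq0E : (0 <= (lambda `^ q)%:E)%E by rewrite lee_fin ltW.
    apply: le_trans (lee_wpmul2l lq0E nuE) _.
    rewrite -EFinM lee_fin mulrCA -powRM ?(ltW l0)//.
    by rewrite le_eqVlt; apply/orP; left; apply/eqP; congr (_ * _ `^ _);
      field; rewrite gt_eqF.
  rewrite fs -EFinM.
  have -> : c `^ q^-1 * (H * C) * s = (c * (H * C * s) `^ q) `^ q^-1.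
    rewrite powRM ?powR_ge0 ?(ltW c0)// -powRrM mulfV// powRr1 ?mulrA//.
    by rewrite mulr_ge0// ltW.
  rewrite -poweR_EFin; apply: gt0_ler_poweR lnuE.
  + by rewrite invr_ge0 ltW.
  + rewrite in_itv/= leey andbT mule_ge0 ?outer_measure_ge0//.
    by rewrite lee_fin ltW.
  + by rewrite in_itv/= leey andbT lee_fin mulr_ge0 ?powR_ge0// ltW.
Qed.
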